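(* There exist uncountably many pairwise non-homeomorphic minimal compact metric spaces $X$ whose homeomorphism group $H(X)$ is degenerate, i.e. $H(X)=\{\mathrm{id}_X\}$. Moreover, for every real number $r\ge 0$ there exists such a space $X$ (with $H(X)=\{\mathrm{id}_X\}$) admitting a minimal map $f:X\to X$ whose topological entropy equals $r$.
   Context: A continuous map $T:X\to X$ on a compact metric space $X$ is minimal if for every $x\in X$ the forward orbit $\{T^n(x):n\in\mathbb{N}\}$ is dense in $X$; a compact space is minimal if it admits a minimal map. $H(X)$ denotes the group of all homeomorphisms of $X$. *)

(* Defs.v *)
From Stdlib Require Import Reals List.
Import ListNotations.
Open Scope R_scope.

Record MetricSpace : Type := {
  carrier :> Type;
  dist : carrier -> carrier -> R;
  dist_nonneg : forall x y, 0 <= dist x y;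
  dist_eq0 : forall x y, dist x y = 0 <-> x = y;
  dist_sym : forall x y, dist x y = dist y x;
  dist_tri : forall x y z, dist x z <= dist x y + dist y z
}.
Arguments dist {m} _ _.

Definition is_open {X : MetricSpace} (U : X -> Prop) : Prop :=
  forall x, U x -> exists e, 0 < e /\ forall y, dist x y < e -> U y.

Definition compact_space (X : MetricSpace) : Prop :=
  forall (I : Type) (U : I -> X -> Prop),
    (forall i, is_open (U i)) ->
    (forall x, exists i, U i x) ->
    exists l : list I, forall x, exists i, In i l /\ U i x.

Definition continuous {X Y : MetricSpace} (f : X -> Y) : Prop :=
  forall x eps, 0 < eps ->
    exists delta, 0 < delta /\
      forall y, dist x y < delta -> dist (f x) (f y) < eps.

Definition is_homeo {X Y : MetricSpace} (f : X -> Y) (g : Y -> X) : Prop :=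
  continuous f /\ continuous g /\
  (forall x, g (f x) = x) /\ (forall y, f (g y) = y).

Definition homeomorphic (X Y : MetricSpace) : Prop :=
  exists (f : X -> Y) (g : Y -> X), is_homeo f g.

Definition trivial_homeo_group (X : MetricSpace) : Prop :=
  forall (f g : X -> X), is_homeo f g -> forall x, f x = x.

Definition minimal_map {X : MetricSpace} (T : X -> X) : Prop :=
  continuous T /\
  forall x y eps, 0 < eps -> exists n : nat, dist (Nat.iter n T x) y < eps.

Definition minimal_space (X : MetricSpace) : Prop :=
  exists T : X -> X, minimal_map T.

Definition n_eps_separated {X : MetricSpace} (T : X -> X) (n : nat) (eps : R)
  (l : list X) : Prop :=
  NoDup l /\
  forall x y, In x l -> In y l -> x <> y ->
    exists k, (k < n)%nat /\ dist (Nat.iter k T x) (Nat.iter k T y) > eps.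

Definition max_sep_card {X : MetricSpace} (T : X -> X) (n : nat) (eps : R)
  (k : nat) : Prop :=
  (exists l, n_eps_separated T n eps l /\ length l = k) /\
  (forall l, n_eps_separated T n eps l -> (length l <= k)%nat).

Definition limsup_eq (u : nat -> R) (L : R) : Prop :=
  (forall e, 0 < e -> exists N, forall n, (N <= n)%nat -> u n <= L + e) /\
  (forall e, 0 < e -> forall N, exists n, (N <= n)%nat /\ L - e <= u n).

(* h_top(T) = r, where h_top(T) = sup_{eps>0} limsup_n (1/n) log s(n,eps)
   (the sup equals lim_{eps->0} since the quantity is monotone in eps). *)
Definition top_entropy_eq {X : MetricSpace} (T : X -> X) (r : R) : Prop :=
  exists h : R -> R,
    (forall eps, 0 < eps ->
       exists s : nat -> nat,
         (forall n, max_sep_card T n eps (s n)) /\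
         limsup_eq (fun n => ln (INR (s (S n))) / INR (S n)) (h eps)) /\
    is_lub (fun y => exists eps, 0 < eps /\ y = h eps) r.

Definition uncountable (I : Type) : Prop :=
  ~ exists f : I -> nat, forall a b, f a = f b -> a = b.

(* Main.v *)
(** Start from a minimal two-sided subshift [C] of entropy [r] and a point [c] of it. Replace, for
    every [n >= 0], the point [T^-n c] by a star [K_n], where the number [legs n] of legs of [K_n]
    is strictly increasing in [n]. The blow-up [X] is the closure of the graph of a map that is
    locally constant on [C] minus [c] and oscillates at [c] densely over an infinite star; the
    continuous map [f : X -> X] lying over the shift sends [K_(n+1)] to [K_n] by collapsing the
    surplus legs and [K_0] to a point. All other fibres are singletons and their union is dense, so
    [f] is minimal; visits near [c] are rare, so blowing up does not change the entropy.

    The fibres are the quasi-components of [X], so a homeomorphism permutes them. A star with [m]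
    legs is recognised by the number of pieces left by removing its centre, hence each [K_n] is
    mapped to itself. The points [T^-n c] are dense in [C], so the homeomorphism covers the identity
    of [C]; it then fixes the singleton fibres, which are dense, and is the identity. The set of leg
    numbers is a topological invariant, which separates uncountably many spaces. *)

From Stdlib Require Import Reals List Lra Lia ZArith Classical ClassicalEpsilon.
From Stdlib Require Import FunctionalExtensionality ProofIrrelevance Cantor.
Require Import Defs.
Import ListNotations.
Open Scope R_scope.

(** * Compactness and counting *)

(** A minimal homeomorphism of such a space would itself be a nontrivial element of its
    homeomorphism group, so the minimal map has to be non-injective, and the identifications must
    not disturb minimality. This is why only the backward orbit of [c] is blown up: along it the
    number of legs drops at each application of the map, and after [K_0] nothing is left to
    collapse; a strictly decreasing count could not continue along the whole two-sided orbit. A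
    single sequence in the infinite star drives all the stars: [K_n] sees its truncation to [legs n]
    legs, and these truncations are compatible with the map. Density of every tail of that sequence
    makes each point of a star a limit of singleton fibres. Total disconnectedness of the subshift
    confines quasi-components to fibres. Compactness and the upper entropy bound come from one and
    the same finite coding of orbit segments. *)

Lemma bounded_family_sup (A : Type) (a0 : A) (v : A -> R) :
  (forall a, v a <= 1) ->
  {s : R | (forall a, v a <= s) /\ forall e, (forall a, v a <= e) -> s <= e}.
Proof.
  intros H.
  destruct (completeness (fun y => exists a, y = v a)) as [s [Hub Hl]].
  - exists 1. intros y [a ->]. apply H.
  - exists (v a0), a0. reflexivity.
  - exists s. split.
    + intros a. apply Hub. exists a. reflexivity.
    + intros e He. apply Hl. intros y [a ->]. apply He.
Qed.

Section SupMetric.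
Context (X A : Type) (a0 : A) (d : A -> X -> X -> R)
  (d_nonneg : forall a x y, 0 <= d a x y) (d_le1 : forall a x y, d a x y <= 1)
  (d_refl : forall a x, d a x x = 0) (d_sym : forall a x y, d a x y = d a y x)
  (d_tri : forall a x y z, d a x z <= d a x y + d a y z)
  (d_sep : forall x y, (forall a, d a x y = 0) -> x = y).

(** A supremum of coordinate pseudometrics rather than a series: a bound [dist x y <= e] is then
    checked one coordinate at a time. *)
Definition sup_dist (x y : X) : R :=
  proj1_sig (bounded_family_sup A a0 (fun a => d a x y) (fun a => d_le1 a x y)).

Lemma sup_dist_le x y e : sup_dist x y <= e <-> forall a, d a x y <= e.
Proof.
  unfold sup_dist. destruct bounded_family_sup as [s [H1 H2]]; simpl. split.
  - intros H a. apply Rle_trans with s; auto.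
  - apply H2.
Qed.

Lemma le_sup_dist a x y : d a x y <= sup_dist x y.
Proof. revert a. apply sup_dist_le. apply Rle_refl. Qed.

Definition sup_metric : MetricSpace.
Proof.
  refine {| carrier := X; dist := sup_dist |}.
  - intros x y. apply Rle_trans with (d a0 x y); auto using le_sup_dist.
  - intros x y. split.
    + intros H. apply d_sep. intros a. apply Rle_antisym; auto.
      rewrite <- H. apply le_sup_dist.
    + intros ->. apply Rle_antisym.
      * apply sup_dist_le. intros a. rewrite d_refl. apply Rle_refl.
      * rewrite <- (d_refl a0 y). apply le_sup_dist.
  - intros x y. apply Rle_antisym; apply sup_dist_le; intros a;
      rewrite d_sym; apply le_sup_dist.
  - intros x y z. apply sup_dist_le. intros a.
    apply Rle_trans with (d a x y + d a y z); auto.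
    apply Rplus_le_compat; apply le_sup_dist.
Defined.

Lemma sup_metric_le (x y : sup_metric) e : dist x y <= e <-> forall a, d a x y <= e.
Proof. apply sup_dist_le. Qed.
End SupMetric.

Lemma Rabs_le_between x e : Rabs x <= e -> - e <= x <= e.
Proof.
  intros H. pose proof (Rle_abs x). pose proof (Rle_abs (- x)).
  rewrite Rabs_Ropp in *. lra.
Qed.

Lemma exp_le a b : a <= b -> exp a <= exp b.
Proof.
  intros H. destruct (Rle_lt_or_eq_dec a b H) as [Hlt|Heq].
  - apply Rlt_le, exp_increasing, Hlt.
  - rewrite Heq. lra.
Qed.

Lemma ln_le a b : 0 < a -> a <= b -> ln a <= ln b.
Proof.
  intros Ha H. destruct (Rle_lt_or_eq_dec a b H) as [Hlt|Heq].
  - apply Rlt_le, ln_increasing; auto.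
  - rewrite Heq. lra.
Qed.

Lemma half_pow_pos n : 0 < (/2)^n.
Proof. apply pow_lt. lra. Qed.

Lemma half_pow_le1 n : (/2)^n <= 1.
Proof. induction n; simpl; [lra|]. pose proof (half_pow_pos n). lra. Qed.

Lemma half_pow_anti n m : (n <= m)%nat -> (/2)^m <= (/2)^n.
Proof.
  induction 1; [lra|]. simpl. pose proof (half_pow_pos m). lra.
Qed.

Lemma half_pow_small e : 0 < e -> exists n, (/2)^n < e.
Proof.
  intros He. destruct (pow_lt_1_zero (/2)) with e as [n Hn]; auto.
  - rewrite Rabs_right; lra.
  - exists n. specialize (Hn n (le_n n)). rewrite Rabs_right in Hn; auto.
    apply Rle_ge, Rlt_le, half_pow_pos.
Qed.

Definition totally_bounded (X : MetricSpace) : Prop :=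
  forall e, 0 < e -> exists l : list X, forall x, exists y, In y l /\ dist y x <= e.

(** A fixed geometric modulus is enough: it is the one produced by the nested balls of the
    compactness proof, and it gives explicit rates for the coordinates. *)
Definition complete (X : MetricSpace) : Prop :=
  forall u : nat -> X,
    (forall n m, (n <= m)%nat -> dist (u n) (u m) <= 2 * (/2)^n) ->
    exists x, forall e, 0 < e -> exists N, forall n, (N <= n)%nat -> dist (u n) x < e.

Section Compactness.
Context (X : MetricSpace) (tb : totally_bounded X) (I : Type) (U : I -> X -> Prop).

Definition fin_cov (S : X -> Prop) : Prop :=
  exists l : list I, forall x, S x -> exists i, In i l /\ U i x.

Lemma not_fin_cov_ball (S : X -> Prop) e : 0 < e -> ~ fin_cov S ->
  exists a, ~ fin_cov (fun x => S x /\ dist a x <= e).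
Proof.
  intros He HS. apply NNPP. intros Hn. apply HS.
  assert (Hall : forall a, fin_cov (fun x => S x /\ dist a x <= e)).
  { intros a. apply NNPP. intros H. apply Hn. exists a. exact H. }
  destruct (tb e He) as [l Hl].
  assert (H : exists li : list I, forall x y, In y l -> S x -> dist y x <= e ->
             exists i, In i li /\ U i x).
  { clear Hl. induction l as [|y l [li IH]].
    - exists nil. intros x y [].
    - destruct (Hall y) as [ly Hy]. exists (ly ++ li).
      intros x z [<-|Hz] Sx Hd.
      + destruct (Hy x) as [i [Hi Ui]]; auto. exists i.
        split; auto. apply in_or_app. auto.
      + destruct (IH x z) as [i [Hi Ui]]; auto. exists i.
        split; auto. apply in_or_app. auto. }
  destruct H as [li H]. exists li. intros x Sx. destruct (Hl x) as [y [Hy Hd]].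
  eauto.
Qed.

Definition big_set := {S : X -> Prop | ~ fin_cov S}.

Definition refine_big (n : nat) (S : big_set) : {a : X | ~ fin_cov (fun x => proj1_sig S x /\ dist a x <= (/2)^n)} :=
  constructive_indefinite_description _
    (not_fin_cov_ball (proj1_sig S) ((/2)^n) (half_pow_pos n) (proj2_sig S)).

Fixpoint big_seq (S0 : big_set) (n : nat) : big_set :=
  match n with
  | O => S0
  | S k => exist (fun S => ~ fin_cov S) _ (proj2_sig (refine_big k (big_seq S0 k)))
  end.

Lemma big_seq_anti S0 n m x : (n <= m)%nat ->
  proj1_sig (big_seq S0 m) x -> proj1_sig (big_seq S0 n) x.
Proof. induction 1; auto. intros [H1 _]. auto. Qed.
End Compactness.

(** Without a finite subcover there are nested sets, each without a finite subcover and the [n]-th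
    refinement lying in a ball of radius [(/2)^n]. The centres converge, and the open set around
    their limit swallows one of these sets, which is thus covered by a single index. *)
Lemma complete_totally_bounded_compact X :
  totally_bounded X -> complete X -> compact_space X.
Proof.
  intros tb cp I U HU Hcov. apply NNPP. intros Hno.
  assert (HX : ~ fin_cov X I U (fun _ => True)).
  { intros [l Hl]. apply Hno. exists l. intros x. apply Hl. exact Logic.I. }
  set (S0 := exist (fun S => ~ fin_cov X I U S) _ HX : big_set X I U).
  set (S := big_seq X tb I U S0).
  set (u := fun n => proj1_sig (refine_big X tb I U n (S n))).
  assert (Hu : forall n m x, (n < m)%nat -> proj1_sig (S m) x -> dist (u n) x <= (/2)^n).
  { intros n m x Hnm Hx. apply (big_seq_anti X tb I U S0 (Datatypes.S n) m) in Hx; auto.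
    destruct Hx as [_ H]. exact H. }
  assert (Hne : forall n, exists x, proj1_sig (S n) x).
  { intros n. apply NNPP. intros H. apply (proj2_sig (S n)). exists nil.
    intros x Hx. exfalso. apply H. eauto. }
  destruct (cp u) as [x Hx].
  { intros n m Hnm. destruct (Hne (Datatypes.S m)) as [y Hy].
    pose proof (Hu n (Datatypes.S m) y ltac:(lia) Hy).
    pose proof (Hu m (Datatypes.S m) y ltac:(lia) Hy).
    pose proof (dist_tri X (u n) y (u m)).
    pose proof (half_pow_anti n m Hnm). rewrite (dist_sym X y (u m)) in *. lra. }
  destruct (Hcov x) as [i Hi]. destruct (HU i x Hi) as [e [He Hb]].
  destruct (Hx (e/2)) as [N1 HN1]; [lra|].
  destruct (half_pow_small (e/2)) as [N2 HN2]; [lra|].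
  set (n := max N1 N2). apply (proj2_sig (S (Datatypes.S n))). exists [i].
  intros y Hy. exists i. split; [left; reflexivity|]. apply Hb.
  pose proof (Hu n (Datatypes.S n) y ltac:(lia) Hy).
  pose proof (HN1 n ltac:(lia)). pose proof (half_pow_anti N2 n ltac:(lia)).
  pose proof (dist_tri X x (u n) y). rewrite (dist_sym X x (u n)) in *. lra.
Qed.

(** Turns a finite list of codes into a finite net of points, even though some codes may not be
    realised. *)
Lemma representatives {X C : Type} (rel : X -> C -> Prop) (L : list C) :
  exists l : list X, forall x c, In c L -> rel x c -> exists y, In y l /\ rel y c.
Proof.
  induction L as [|c L [l IH]].
  - exists nil. intros x c [].
  - destruct (classic (exists y, rel y c)) as [[y Hy]|Hn].
    + exists (y :: l). intros x c' [<-|H] Hr.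
      * exists y. simpl. auto.
      * destruct (IH x c' H Hr) as [z [Hz Hzr]]. exists z. simpl. auto.
    + exists l. intros x c' [<-|H] Hr; [exfalso; eauto|eauto].
Qed.

Lemma NoDup_map_in {X C : Type} (f : X -> C) (l : list X) :
  NoDup l -> (forall x y, In x l -> In y l -> f x = f y -> x = y) -> NoDup (map f l).
Proof.
  induction 1 as [|a l Ha Hl IH]; intros Hf; simpl; constructor.
  - intros H. apply in_map_iff in H. destruct H as [b [Hb Hin]].
    apply Ha. rewrite <- (Hf b a); simpl; auto.
  - apply IH. intros x y Hx Hy. apply Hf; simpl; auto.
Qed.

(** The pigeonhole principle for codes given by a relation, since a point may have several codes;
    [epsilon] selects one. *)
Lemma length_le_codes {X C : Type} (rel : X -> C -> Prop) (l : list X) (L : list C) :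
  NoDup l -> (forall x, In x l -> exists c, In c L /\ rel x c) ->
  (forall x y c, In x l -> In y l -> rel x c -> rel y c -> x = y) ->
  (length l <= length L)%nat.
Proof.
  intros Hnd Hc Hinj. destruct l as [|x0 l0] eqn:El; [simpl; lia|]. rewrite <- El in *.
  assert (Hx0 : In x0 l) by (rewrite El; simpl; auto).
  destruct (Hc x0 Hx0) as [c0 _].
  set (f := fun x => epsilon (inhabits c0) (fun c => In c L /\ rel x c)).
  assert (Hf : forall x, In x l -> In (f x) L /\ rel x (f x)).
  { intros x Hx. apply (epsilon_spec (inhabits c0) (fun c => In c L /\ rel x c)). auto. }
  rewrite <- (length_map f). apply NoDup_incl_length.
  - apply NoDup_map_in; auto. intros x y Hx Hy E. apply (Hinj x y (f x)); auto.
    + apply Hf; auto.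
    + rewrite E. apply Hf; auto.
  - intros c H. apply in_map_iff in H. destruct H as [x [<- Hx]]. apply Hf; auto.
Qed.

Fixpoint tuples (B v : nat) : list (list nat) :=
  match v with
  | O => [nil]
  | S v => map (fun p => fst p :: snd p) (list_prod (seq 0 B) (tuples B v))
  end.

Lemma length_tuples B v : length (tuples B v) = (B ^ v)%nat.
Proof.
  induction v; simpl; auto. rewrite length_map, length_prod, length_seq, IHv. reflexivity.
Qed.

Lemma in_tuples B (g : nat -> nat) v s : (forall j, (g j < B)%nat) ->
  In (map g (seq s v)) (tuples B v).
Proof.
  intros Hg. revert s. induction v; intros s; simpl; auto.
  apply in_map_iff. exists (g s, map g (seq (S s) v)). split; auto.
  apply in_prod; auto. apply in_seq. specialize (Hg s). lia.
Qed.

Lemma exists_max (P : nat -> Prop) M : P 0%nat -> (forall k, P k -> (k <= M)%nat) ->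
  exists k, P k /\ forall j, P j -> (j <= k)%nat.
Proof.
  intros H0. induction M as [|M IH]; intros HM.
  - exists 0%nat. auto.
  - destruct (classic (P (S M))) as [H|H]; [eauto|]. apply IH. intros k Hk.
    specialize (HM k Hk). destruct (Nat.eq_dec k (S M)); [subst; contradiction|lia].
Qed.

Definition locally_constant_on {T} (a b : R) (P : R -> T) : Prop :=
  forall t, a <= t <= b -> exists d, 0 < d /\
    forall t', a <= t' <= b -> Rabs (t' - t) < d -> P t' = P t.

(** Connectedness of the interval, by the supremum of the points where [P] takes its initial value.
    It will be applied along the legs of a star. *)
Lemma locally_constant_interval {T} (a b : R) (P : R -> T) :
  a <= b -> locally_constant_on a b P -> P a = P b.
Proof.
  intros Hab HP.
  destruct (completeness (fun t => a <= t <= b /\ P t = P a)) as [m [Hub Hl]].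
  - exists b. intros t [[_ H] _]. exact H.
  - exists a. split; [lra|auto].
  - assert (Ham : a <= m) by (apply Hub; split; [lra|auto]).
    assert (Hmb : m <= b) by (apply Hl; intros t [[_ H] _]; exact H).
    destruct (HP m) as [d [Hd HPd]]; [lra|].
    assert (exists t, (a <= t <= b /\ P t = P a) /\ m - d < t) as [t [[Ht HPt] Hmt]].
    { apply NNPP. intros Hn. assert (m <= m - d); [|lra]. apply Hl.
      intros t Ht. apply Rnot_lt_le. intros Hlt. apply Hn. eauto. }
    assert (t <= m) by (apply Hub; auto).
    assert (HPm : P m = P a) by (rewrite <- HPt; symmetry; apply HPd; [lra|];
      rewrite Rabs_left1; lra).
    destruct (Rle_lt_or_eq_dec m b Hmb) as [Hlt|<-]; auto.
    set (t' := Rmin b (m + d/2)).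
    assert (Ht' : m < t' <= b /\ t' <= m + d/2).
    { unfold t', Rmin. destruct (Rle_dec b (m+d/2)); lra. }
    assert (t' <= m); [|lra]. apply Hub. split; [lra|].
    rewrite <- HPm. apply HPd; [lra|]. rewrite Rabs_right; lra.
Qed.

(** * Minimal subshifts of prescribed entropy *)

Definition word (x : Z -> nat) (a : Z) (n : nat) : list nat :=
  map (fun j => x (a + Z.of_nat j)%Z) (seq 0 n).

(* [recurrent] gives density of forward orbits (take [a] positive) and of backward orbits
   (take [a + G] negative) at once. *)
Record subshift (r : R) := {
  pts : (Z -> nat) -> Prop;
  base : Z -> nat;
  base_in : pts base;
  shift_in : forall x k, pts x -> pts (fun m => x (m + k)%Z);
  pts_closed : forall x,
    (forall Q, exists y, pts y /\ forall m, (Z.abs m < Q)%Z -> y m = x m) -> pts x;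
  recurrent : forall x y Q, pts x -> pts y -> exists G, forall a, exists t,
    (a <= t <= a + G)%Z /\ forall m, (Z.abs m < Q)%Z -> x (m + t)%Z = y m;
  aperiodic : forall t, t <> 0%Z -> exists m, base (m + t)%Z <> base m;
  words_le : forall e, 0 < e -> exists A, forall n, exists L : list (list nat),
    INR (length L) <= exp (A + (r + e) * INR n) /\
    forall x, pts x -> In (word x 0 n) L;
  words_ge : forall N, exists n, (N <= n)%nat /\ exists l : list (Z -> nat),
    exp (r * INR n) <= INR (length l) /\ (forall x, In x l -> pts x) /\
    NoDup (map (fun x => word x 0 n) l)
}.

(* [N] words of length [L] are concatenated, [l] at a time, to [N'] words of length [l * L]: the
   first [N] factors list all the words, which makes the subshift minimal, and the remaining
   [l - N] are free, so [N'] can be anything up to [N ^ (l - N)]; it is taken just above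
   [exp (r * l * L)]. *)
Record block_step (r d : R) (L N l N' : nat) : Prop := {
  step_len : (N + 1 <= l)%nat;
  step_lt : (N < N')%nat;
  step_le : (N' <= N ^ (l - N))%nat;
  step_exp_lt : exp (r * INR (l * L)) < INR N';
  step_exp_le : INR N' <= exp ((r + d) * INR (l * L))
}.

Lemma exp_mult_INR a n : exp (a * INR n) = exp a ^ n.
Proof.
  induction n as [|n IH].
  - simpl. rewrite Rmult_0_r. apply exp_0.
  - rewrite S_INR. simpl. rewrite <- IH, <- exp_plus. f_equal. ring.
Qed.

Lemma pow_unbounded a b : 1 < a -> exists n, forall m, (n <= m)%nat -> b <= a ^ m.
Proof.
  intros Ha. destruct (Pow_x_infinity a) with b as [n Hn].
  - rewrite Rabs_right; lra.
  - exists n. intros m Hm. specialize (Hn m Hm). rewrite Rabs_right in Hn; [lra|].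
    apply Rle_ge, pow_le. lra.
Qed.

(** Put [a = exp (r * L)]. Because [a < N], the [N ^ (l - N)] available words outgrow any constant
    multiple of [a ^ l], so for large [l] the count can be placed just above [a ^ l]. The new count
    again satisfies the strict inequality, so the step can be iterated. *)
Lemma block_step_exists r d L N : 0 <= r -> 0 < d -> (1 <= L)%nat -> (2 <= N)%nat ->
  exp (r * INR L) < INR N -> exists l N', block_step r d L N l N'.
Proof.
  intros Hr Hd HL HN HrN.
  set (a := exp (r * INR L)) in *.
  assert (HL1 : 1 <= INR L) by (apply (le_INR 1); auto).
  assert (HN2 : 2 <= INR N) by (apply (le_INR 2); auto).
  assert (Ha : 1 <= a).
  { unfold a. destruct (Req_dec r 0) as [->|Hr0]; [rewrite Rmult_0_l, exp_0; lra|].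
    pose proof (exp_ineq1 (r * INR L)). assert (0 < r * INR L) by nra.
    assert (r * INR L <> 0) by lra. specialize (H H1). lra. }
  (* [n1] secures [N' <= N ^ (l - N)] and [n2] the upper bound at rate [r + d]; both compare with
     the estimate [N' <= a ^ l * (N + 2)]. *)
  destruct (pow_unbounded (INR N / a) ((INR N + 2) * INR N ^ N)) as [n1 H1].
  { apply Rmult_lt_reg_r with a; [lra|]. unfold Rdiv. rewrite Rmult_assoc, Rinv_l; lra. }
  destruct (pow_unbounded (exp (d * INR L)) (INR N + 2)) as [n2 H2].
  { rewrite <- exp_0. apply exp_increasing. nra. }
  set (l := (N + 1 + n1 + n2)%nat). specialize (H1 l ltac:(lia)). specialize (H2 l ltac:(lia)).
  (* [up] puts the count above the exponential; the summand [N] makes it exceed [N] as well. *)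
  set (N' := (Z.to_nat (up (exp (r * INR (l * L)))) + N)%nat).
  assert (El : exp (r * INR (l * L)) = a ^ l).
  { unfold a. rewrite <- exp_mult_INR, mult_INR. f_equal. ring. }
  destruct (archimed (exp (r * INR (l * L)))) as [Hup1 Hup2].
  assert (Hpos := exp_pos (r * INR (l * L))).
  assert (Hup0 : (0 <= up (exp (r * INR (l * L))))%Z).
  { apply le_IZR. lra. }
  assert (EN' : INR N' = IZR (up (exp (r * INR (l * L)))) + INR N).
  { unfold N'. rewrite plus_INR, INR_IZR_INZ, Z2Nat.id; auto. }
  assert (Hal : 1 <= a ^ l) by (apply pow_R1_Rle; auto).
  assert (HN' : INR N' <= a ^ l * (INR N + 2)) by (rewrite EN', <- El in *; nra).
  exists l, N'. constructor.
  - lia.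
  - assert (0 < up (exp (r * INR (l * L))))%Z; [|lia]. apply lt_IZR. lra.
  - apply INR_le. rewrite pow_INR.
    assert (HNN : 0 < INR N ^ N) by (apply pow_lt; lra).
    apply Rmult_le_reg_r with (INR N ^ N); auto.
    rewrite <- pow_add. replace (l - N + N)%nat with l by lia.
    unfold Rdiv in H1. rewrite Rpow_mult_distr, pow_inv in H1.
    apply Rle_trans with (a ^ l * ((INR N + 2) * INR N ^ N)); [nra|].
    apply Rmult_le_reg_l with (/ a ^ l); [apply Rinv_0_lt_compat; lra|].
    rewrite <- Rmult_assoc, Rinv_l, Rmult_1_l by lra. lra.
  - lra.
  - replace ((r + d) * INR (l * L)) with (r * INR (l * L) + (d * INR L) * INR l)
      by (rewrite mult_INR; ring).
    rewrite exp_plus, El, exp_mult_INR.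
    apply Rle_trans with (a ^ l * (INR N + 2)); auto.
    apply Rmult_le_compat_l; lra.
Qed.

(** The tolerance [/ INR (S k)] tends to zero, so the exponential growth rates of [num k] relative
    to [len k] are squeezed to [r] from above. Level [0] consists of single letters. *)
Record block_params (r : R) := {
  len : nat -> nat;
  num : nat -> nat;
  mul : nat -> nat;
  len_0 : len 0 = 1%nat;
  len_S : forall k, len (S k) = (mul k * len k)%nat;
  num_0 : (2 <= num 0)%nat;
  num_exp_0 : exp (r * INR (len 0)) < INR (num 0);
  params_step : forall k, block_step r (/ INR (S k)) (len k) (num k) (mul k) (num (S k))
}.

(** Carries the hypotheses of [block_step_exists] along, so that the parameters can be produced by a
    fixpoint. *)
Definition good_pair (r : R) : Type :=
  {p : nat * nat | (1 <= fst p)%nat /\ (2 <= snd p)%nat /\ exp (r * INR (fst p)) < INR (snd p)}.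

Lemma next_pair_exists r (Hr : 0 <= r) (k : nat) (p : good_pair r) :
  exists q : nat * nat, block_step r (/ INR (S k)) (fst (proj1_sig p)) (snd (proj1_sig p)) (fst q) (snd q).
Proof.
  destruct p as [[L N] [H1 [H2 H3]]]; simpl in *.
  destruct (block_step_exists r (/ INR (S k)) L N) as [l [N' H]]; auto.
  - apply Rinv_0_lt_compat. apply lt_0_INR. lia.
  - exists (l, N'). exact H.
Qed.

Lemma block_params_exist r : 0 <= r -> inhabited (block_params r).
Proof.
  intros Hr.
  set (nx := fun k p => constructive_indefinite_description _ (next_pair_exists r Hr k p)).
  assert (Hgood : forall k (p : good_pair r),
    (1 <= fst (proj1_sig (nx k p)) * fst (proj1_sig p))%nat /\ (2 <= snd (proj1_sig (nx k p)))%nat /\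
    exp (r * INR (fst (proj1_sig (nx k p)) * fst (proj1_sig p))) < INR (snd (proj1_sig (nx k p)))).
  { intros k p. destruct (nx k p) as [[l N'] H]. destruct p as [[L N] [H1 [H2 H3]]].
    simpl in *. destruct H. repeat split; auto; try lia.
    destruct l; [lia|]. destruct L; [lia|]. simpl. lia. }
  destruct (Pow_x_infinity 2) with (exp (r * INR 1) + 1) as [n0 Hn0];
    [rewrite Rabs_right; lra|].
  specialize (Hn0 n0 (le_n n0)).
  assert (H0 : (1 <= fst (1, S (2 ^ n0)))%nat /\ (2 <= snd (1, S (2 ^ n0)))%nat /\
     exp (r * INR (fst (1, S (2 ^ n0))%nat)) < INR (snd (1, S (2 ^ n0)%nat))).
  { simpl fst. simpl snd. split; [lia|]. split.
    - pose proof (Nat.pow_nonzero 2 n0). lia.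
    - rewrite (S_INR (2 ^ n0)), pow_INR. change (INR 2) with 2. rewrite Rabs_right in Hn0; [lra|].
      apply Rle_ge, pow_le. lra. }
  set (sq := fix sq (k : nat) : good_pair r :=
    match k with
    | O => exist _ (1, S (2 ^ n0))%nat H0
    | S k => exist _ ((fst (proj1_sig (nx k (sq k))) * fst (proj1_sig (sq k)))%nat,
                      snd (proj1_sig (nx k (sq k)))) (Hgood k (sq k))
    end).
  constructor.
  refine {| len := fun k => fst (proj1_sig (sq k)); num := fun k => snd (proj1_sig (sq k));
            mul := fun k => fst (proj1_sig (nx k (sq k))) |}; auto.
  - apply H0.
  - apply H0.
  - intros k. simpl. destruct (nx k (sq k)) as [q Hq]. exact Hq.
Qed.

(** * Words assembled level by level *)

Lemma base_digits_inj B n i i' : (i < B ^ n)%nat -> (i' < B ^ n)%nat -> i <> i' ->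
  exists j, (j < n)%nat /\ ((i / B ^ j) mod B)%nat <> ((i' / B ^ j) mod B)%nat.
Proof.
  revert i i'. induction n as [|n IH]; intros i i' Hi Hi' Hne; simpl in Hi, Hi'; [lia|].
  assert (HB : B <> 0%nat) by (intros ->; lia).
  destruct (Nat.eq_dec (i mod B) (i' mod B)) as [E|E].
  - destruct (IH (i / B) (i' / B))%nat as [j [Hj Hd]].
    + apply Nat.Div0.div_lt_upper_bound; auto.
    + apply Nat.Div0.div_lt_upper_bound; auto.
    + intros E'. apply Hne. rewrite (Nat.div_mod_eq i B), (Nat.div_mod_eq i' B). congruence.
    + exists (S j). split; [lia|]. simpl. rewrite <- !Nat.Div0.div_div. exact Hd.
  - exists 0%nat. split; [lia|]. rewrite Nat.pow_0_r, !Nat.div_1_r. exact E.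
Qed.

Section Blocks.
Context {r : R} (P : block_params r).
Notation L := (len r P).
Notation N := (num r P).
Notation l := (mul r P).

Lemma num_ge2 k : (2 <= N k)%nat.
Proof.
  induction k; [apply num_0|]. pose proof (step_lt _ _ _ _ _ _ (params_step r P k)). lia.
Qed.

Lemma num_ge k : (k + 2 <= N k)%nat.
Proof.
  induction k; [apply num_0|]. pose proof (step_lt _ _ _ _ _ _ (params_step r P k)). lia.
Qed.

Lemma mul_gt k : (N k + 1 <= l k)%nat.
Proof. apply (step_len _ _ _ _ _ _ (params_step r P k)). Qed.

Lemma len_pos k : (1 <= L k)%nat.
Proof.
  induction k; [rewrite len_0; auto|]. rewrite len_S. pose proof (mul_gt k). nia.
Qed.

Lemma len_S_ge k : (3 * L k <= L (S k))%nat.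
Proof. rewrite len_S. pose proof (mul_gt k). pose proof (num_ge2 k). nia. Qed.

Lemma len_gt k : (k < L k)%nat.
Proof. induction k; [apply len_pos|]. pose proof (len_S_ge k). lia. Qed.

Lemma num_exp_lt k : exp (r * INR (L k)) < INR (N k).
Proof.
  destruct k; [apply num_exp_0|].
  rewrite len_S. apply (step_exp_lt _ _ _ _ _ _ (params_step r P k)).
Qed.

(** Factor [j] of word [i] of level [k + 1]: the first [N k] factors enumerate all words of level
    [k], the others spell [i] in base [N k]. The latter tells the words apart, because
    [N (k + 1) <= N k ^ (l k - N k)]. *)
Definition digit (k i j : nat) : nat :=
  if (j <? N k)%nat then j else ((i / N k ^ (j - N k)) mod N k)%nat.

Fixpoint block (k i p : nat) : nat :=
  match k with
  | O => i
  | S k => block k (digit k i (p / L k)) (p mod L k)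
  end.

Lemma digit_lt k i j : (digit k i j < N k)%nat.
Proof.
  unfold digit. pose proof (num_ge2 k). destruct (Nat.ltb_spec j (N k)); auto.
  apply Nat.mod_upper_bound. lia.
Qed.

Lemma block_sub k i j p : (p < L k)%nat ->
  block (S k) i (j * L k + p) = block k (digit k i j) p.
Proof.
  intros Hp. simpl. rewrite Nat.div_add_l, Nat.div_small, Nat.add_0_r by lia.
  rewrite Nat.add_comm, Nat.Div0.mod_add, Nat.mod_small; auto.
Qed.

Lemma block_list k i j p : (j < N k)%nat -> (p < L k)%nat ->
  block (S k) i (j * L k + p) = block k j p.
Proof.
  intros Hj Hp. rewrite block_sub; auto. unfold digit.
  destruct (Nat.ltb_spec j (N k)); auto. lia.
Qed.

Lemma block_inj k i i' : (i < N k)%nat -> (i' < N k)%nat -> i <> i' ->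
  exists p, (p < L k)%nat /\ block k i p <> block k i' p.
Proof.
  revert i i'. induction k as [|k IH]; intros i i' Hi Hi' Hne.
  - exists 0%nat. rewrite len_0. simpl. auto.
  - pose proof (step_le _ _ _ _ _ _ (params_step r P k)).
    destruct (base_digits_inj (N k) (l k - N k) i i') as [j [Hj Hd]]; auto; try lia.
    destruct (IH (digit k i (N k + j)) (digit k i' (N k + j))) as [p [Hp Hb]];
      auto using digit_lt.
    { unfold digit. destruct (Nat.ltb_spec (N k + j) (N k)); [lia|].
      replace (N k + j - N k)%nat with j by lia. exact Hd. }
    exists ((N k + j) * L k + p)%nat. split; [rewrite len_S; nia|].
    rewrite !block_sub; auto.
Qed.

Definition occurs (K : nat) (x : Z -> nat) (a : Z) (n : nat) : Prop :=
  exists i p, (i < N K)%nat /\ (p + n <= L K)%nat /\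
    forall j, (j < n)%nat -> x (a + Z.of_nat j)%Z = block K i (p + j).

(** Word [i] of one level is factor [i] of word [0] of the next, by the enumerating part. *)
Lemma occurs_mono K K' x a n : (K <= K')%nat -> occurs K x a n -> occurs K' x a n.
Proof.
  induction 1 as [|K' _ IH]; auto. intros H. destruct (IH H) as [i [p [Hi [Hp Hj]]]].
  exists 0%nat, (i * L K' + p)%nat. pose proof (num_ge2 (S K')). split; [lia|]. split.
  - rewrite len_S. pose proof (mul_gt K'). nia.
  - intros j Hjn. rewrite Hj, <- Nat.add_assoc, block_list; auto. lia.
Qed.

(** [block] recurses from the top level; this unfolds it down to level [k], by induction on the
    number of levels opened. It lays a grid of fixed mesh on words of arbitrarily high level. *)
Lemma block_decompose k K i : (k <= K)%nat -> (i < N K)%nat -> exists idx : nat -> nat,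
  (forall q, (idx q < N k)%nat) /\
  forall p, (p < L K)%nat -> block K i p = block k (idx (p / L k)%nat) (p mod L k).
Proof.
  intros Hk Hi. replace k with (K - (K - k))%nat by lia.
  assert (Hd : (K - k <= K)%nat) by lia. revert Hd. generalize (K - k)%nat as d.
  induction d as [|d IH]; intros Hd.
  - exists (fun _ => i). rewrite Nat.sub_0_r. split; auto.
    intros p Hp. rewrite Nat.mod_small; auto.
  - destruct IH as [idx [H1 H2]]; [lia|].
    replace (K - d)%nat with (S (K - S d)) in * by lia. set (k' := (K - S d)%nat) in *.
    exists (fun q => digit k' (idx (q / l k')%nat) (q mod l k')). split.
    + intros q. apply digit_lt.
    + intros p Hp. rewrite H2 by auto. simpl block.
      rewrite len_S. pose proof (len_pos k'). pose proof (mul_gt k').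
      rewrite (Nat.mul_comm (l k')), Nat.Div0.mod_mul_r, <- Nat.Div0.div_div.
      rewrite (Nat.mul_comm (L k') (_ mod _)), Nat.div_add by lia.
      rewrite (Nat.div_small (p mod L k')) by (apply Nat.mod_upper_bound; lia).
      rewrite Nat.Div0.mod_add, Nat.Div0.mod_mod. reflexivity.
Qed.

Definition block_pts (x : Z -> nat) : Prop := forall a n, exists K, occurs K x a n.

(** A window of twice the length of level [K + 1] contains a complete aligned word of that level,
    which lists every word of level [K]. This bounded gap is the source of minimality. *)
Lemma block_appears x K i a : block_pts x -> (i < N K)%nat -> exists t,
  (a <= t < a + 2 * Z.of_nat (L (S K)))%Z /\
  forall j, (j < L K)%nat -> x (t + Z.of_nat j)%Z = block K i j.
Proof.
  intros Hx Hi. destruct (Hx a (2 * L (S K))%nat) as [K0 HK0].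
  apply (occurs_mono _ (max K0 (S K))) in HK0; [|lia].
  destruct HK0 as [i' [p [Hi' [Hp Hj]]]].
  destruct (block_decompose (S K) (max K0 (S K)) i') as [idx [_ Hidx]]; auto; [lia|].
  pose proof (len_pos (S K)) as HL.
  (* [q] is [p / L'] rounded up: the first aligned word starting at or after position [p]. *)
  set (L' := L (S K)) in *. set (q := ((p + L' - 1) / L')%nat).
  assert (Hq : (p <= q * L' < p + L')%nat).
  { unfold q. pose proof (Nat.div_mod_eq (p + L' - 1) L').
    pose proof (Nat.mod_upper_bound (p + L' - 1) L' ltac:(lia)). nia. }
  assert (HiL : (i * L K + L K <= L')%nat).
  { unfold L'. rewrite len_S. pose proof (mul_gt K). nia. }
  exists (a + Z.of_nat (q * L' - p + i * L K))%Z. split; [lia|].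
  intros j Hjl.
  replace (a + Z.of_nat (q * L' - p + i * L K) + Z.of_nat j)%Z
    with (a + Z.of_nat (q * L' - p + i * L K + j))%Z by lia.
  rewrite Hj by lia.
  replace (p + (q * L' - p + i * L K + j))%nat with ((i * L K + j) + q * L')%nat by lia.
  rewrite Hidx by lia.
  rewrite Nat.Div0.mod_add, Nat.mod_small by lia. apply block_list; auto.
Qed.

Lemma block_recurrent x y Q : block_pts x -> block_pts y -> exists G, forall a, exists t,
  (a <= t <= a + G)%Z /\ forall m, (Z.abs m < Q)%Z -> x (m + t)%Z = y m.
Proof.
  intros Hx Hy. destruct (Hy (- Q)%Z (Z.to_nat (2 * Q))) as [K [i [p [Hi [Hp Hj]]]]].
  exists (2 * Z.of_nat (L (S K)))%Z. intros a.
  destruct (block_appears x K i (a - Z.of_nat p - Q) Hx Hi) as [t [Ht Hb]].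
  exists (t + Z.of_nat p + Q)%Z. split; [lia|]. intros m Hm.
  replace m with (- Q + Z.of_nat (Z.to_nat (m + Q)))%Z at 2 by lia.
  rewrite Hj by lia. rewrite <- Hb by lia. f_equal. lia.
Qed.

(** Under a period [t], the word read at a position depends only on the position modulo [|t|], so at
    most [|t|] words of a given length occur. But level [|t|] has more than [|t|] distinct words,
    and all of them appear. *)
Lemma block_aperiodic x t : block_pts x -> t <> 0%Z -> exists m, x (m + t)%Z <> x m.
Proof.
  intros Hx Ht. apply NNPP. intros Hn.
  assert (Hper : forall m, x (m + t)%Z = x m).
  { intros m. apply NNPP. eauto. }
  assert (Hper' : forall s m, x (m + s * t)%Z = x m).
  { intros s. induction s as [|s IH|s IH] using Z.peano_ind; intros m.
    - f_equal. lia.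
    - rewrite <- (IH m), <- (Hper (m + s * t)%Z). f_equal. lia.
    - rewrite <- (IH m), <- (Hper (m + Z.pred s * t)%Z). f_equal. lia. }
  set (u := Z.abs_nat t). pose proof (num_ge u).
  assert (length (seq 0 (N u)) <= length (seq 0 u))%nat; [|rewrite !length_seq in *; lia].
  apply (length_le_codes (fun i c => exists s, (s mod Z.abs t)%Z = Z.of_nat c /\
     forall j, (j < L u)%nat -> x (s + Z.of_nat j)%Z = block u i j)).
  - apply seq_NoDup.
  - intros i Hi. apply in_seq in Hi.
    destruct (block_appears x u i 0 Hx) as [s [_ Hs]]; [lia|].
    pose proof (Z.mod_pos_bound s (Z.abs t) ltac:(lia)).
    exists (Z.to_nat (s mod Z.abs t)). split; [apply in_seq; lia|].
    exists s. split; auto. lia.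
  - intros i i' c Hi Hi' [s [Hs Hb]] [s' [Hs' Hb']].
    apply in_seq in Hi. apply in_seq in Hi'.
    destruct (Nat.eq_dec i i') as [E|E]; auto. exfalso.
    destruct (block_inj u i i') as [p [Hp Hpn]]; auto; try lia.
    apply Hpn. rewrite <- Hb, <- Hb' by auto.
    assert (exists w, s = s' + w * t)%Z as [w ->].
    { rewrite (Z.div_mod s (Z.abs t)), (Z.div_mod s' (Z.abs t)), Hs, Hs' by lia.
      exists ((s / Z.abs t - s' / Z.abs t) * Z.sgn t)%Z.
      replace (Z.abs t) with (Z.sgn t * t)%Z by lia. ring. }
    rewrite <- (Hper' w (s' + Z.of_nat p)%Z). f_equal. lia.
Qed.

(* [block k 1] sits inside [block (k + 1) 1] at offset [L k], with room on both sides; the nested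
   union of these blocks is a two-sided sequence, whose coordinate [0] is at position [origin k]
   of [block k 1]. *)
Fixpoint origin (k : nat) : nat :=
  match k with O => O | S k => (L k + origin k)%nat end.

(** The margins on both sides of the origin grow without bound, so the nested words exhaust all
    integers; level [|m| + 1] already covers coordinate [m]. *)
Lemma origin_bounds k : (k <= origin k)%nat /\ (origin k + k < L k)%nat.
Proof.
  induction k as [|k IH]; simpl; [rewrite len_0; lia|].
  pose proof (len_S_ge k). pose proof (len_gt k). lia.
Qed.

Definition block_base (m : Z) : nat :=
  block (S (Z.abs_nat m)) 1 (Z.to_nat (Z.of_nat (origin (S (Z.abs_nat m))) + m)).

Lemma block_origin k k' m : (Z.abs_nat m <= k)%nat -> (k <= k')%nat ->
  block k' 1 (Z.to_nat (Z.of_nat (origin k') + m)) =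
  block k 1 (Z.to_nat (Z.of_nat (origin k) + m)).
Proof.
  intros Hm. induction 1 as [|k' Hk IH]; auto. rewrite <- IH.
  pose proof (origin_bounds k'). pose proof (num_ge2 k').
  replace (Z.to_nat (Z.of_nat (origin (S k')) + m))
    with (1 * L k' + Z.to_nat (Z.of_nat (origin k') + m))%nat by (simpl; lia).
  apply block_list; lia.
Qed.

Lemma block_base_in : block_pts block_base.
Proof.
  intros a n. set (K := (Z.abs_nat a + n + 1)%nat). exists K.
  exists 1%nat, (Z.to_nat (Z.of_nat (origin K) + a)).
  pose proof (origin_bounds K). pose proof (num_ge2 K). split; [lia|]. split; [lia|].
  intros j Hj. unfold block_base.
  rewrite <- (block_origin (S (Z.abs_nat (a + Z.of_nat j))) K) by lia.
  f_equal. lia.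
Qed.

(** A word of length [n] is covered by [n / L k + 2] consecutive words of level [k], hence
    determined by an offset below [L k] and their indices. The level is chosen so that
    [N k <= exp ((r + e) * L k)]. *)
Lemma block_words_le e : 0 <= r -> 0 < e -> exists A, forall n, exists W : list (list nat),
  INR (length W) <= exp (A + (r + e) * INR n) /\
  forall x, block_pts x -> In (word x 0 n) W.
Proof.
  intros Hr He. destruct (archimed_cor1 e He) as [k0 [Hk0 Hk0pos]].
  destruct k0 as [|k']; [lia|].
  set (k := S k') in *.
  pose proof (len_pos k) as HL. pose proof (num_ge2 k) as HN.
  assert (HL1 : 1 <= INR (L k)) by (apply (le_INR 1); auto).
  assert (HNk : INR (N k) <= exp ((r + e) * INR (L k))).
  { pose proof (step_exp_le _ _ _ _ _ _ (params_step r P k')) as H.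
    rewrite <- len_S in H. apply Rle_trans with (1 := H).
    apply Rlt_le, exp_increasing, Rmult_lt_compat_r; [|fold k]; lra. }
  (* The logarithm accounts for the offset, the other term for the two partially covered words at
     the ends. *)
  exists (ln (INR (L k)) + (r + e) * (2 * INR (L k))). intros n.
  set (v := (n / L k + 2)%nat).
  set (W := map (fun c => map (fun j => block k (nth ((fst c + j) / L k) (snd c) 0%nat)
                                              ((fst c + j) mod L k)) (seq 0 n))
                (list_prod (seq 0 (L k)) (tuples (N k) v))).
  exists W. split.
  - unfold W. rewrite length_map, length_prod, length_seq, length_tuples, mult_INR, pow_INR.
    rewrite Rplus_assoc, exp_plus, exp_ln by lra. apply Rmult_le_compat_l; [lra|].
    apply Rle_trans with (exp ((r + e) * INR (L k)) ^ v).
    + apply pow_incr. split; [apply pos_INR|auto].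
    + rewrite <- exp_mult_INR. rewrite Rmult_assoc, <- mult_INR, <- Rmult_plus_distr_l.
      change 2 with (INR 2). rewrite <- mult_INR, <- plus_INR.
      assert (Hle : (L k * v <= 2 * L k + n)%nat).
      { unfold v. pose proof (Nat.div_mod_eq n (L k)). nia. }
      apply le_INR in Hle.
      destruct (Rle_lt_or_eq_dec _ _ Hle) as [Hlt|Heq]; [|rewrite Heq; lra].
      apply Rlt_le, exp_increasing, Rmult_lt_compat_l; lra.
  - intros x Hx. destruct (Hx 0%Z n) as [K HK].
    apply (occurs_mono _ (max K k)) in HK; [|lia].
    destruct HK as [i [p [Hi [Hp Hj]]]].
    destruct (block_decompose k (max K k) i) as [idx [Hlt Hidx]]; auto; [lia|].
    apply in_map_iff.
    exists ((p mod L k)%nat, map (fun q => idx (p / L k + q)%nat) (seq 0 v)). split.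
    + unfold word. apply map_ext_in. intros j Hjn. apply in_seq in Hjn.
      rewrite Hj, Hidx by lia. simpl fst. simpl snd.
      assert (Hmod : (p mod L k < L k)%nat) by (apply Nat.mod_upper_bound; lia).
      assert (E : (p + j = p / L k * L k + (p mod L k + j))%nat).
      { pose proof (Nat.div_mod_eq p (L k)). lia. }
      assert (Hq : ((p mod L k + j) / L k < v)%nat).
      { unfold v. apply Nat.Div0.div_lt_upper_bound.
        pose proof (Nat.div_mod_eq n (L k)).
        pose proof (Nat.mod_upper_bound n (L k) ltac:(lia)). nia. }
      rewrite (nth_indep _ 0%nat (idx (p / L k + 0)%nat)) by (rewrite length_map, length_seq; auto).
      rewrite (map_nth (fun q => idx (p / L k + q)%nat)), seq_nth by auto.
      rewrite E at 1 2. rewrite Nat.div_add_l, Nat.add_0_l by lia.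
      rewrite (Nat.add_comm (p / L k * L k)), Nat.Div0.mod_add. reflexivity.
    + apply in_prod.
      * apply in_seq. pose proof (Nat.mod_upper_bound p (L k)). lia.
      * apply (in_tuples (N k) (fun q => idx (p / L k + q)%nat)). auto.
Qed.

(** For [n = L M] the words of level [M] are distinct, all appear in the base sequence, and
    outnumber [exp (r * n)]. Such lengths are unbounded, which suffices for a limsup. *)
Lemma block_words_ge M : exists n, (M <= n)%nat /\ exists l : list (Z -> nat),
  exp (r * INR n) <= INR (length l) /\ (forall x, In x l -> block_pts x) /\
  NoDup (map (fun x => word x 0 n) l).
Proof.
  exists (L M). split; [pose proof (len_gt M); lia|].
  assert (H : forall i, exists x, (i < N M)%nat -> block_pts x /\
             forall j, (j < L M)%nat -> x (0 + Z.of_nat j)%Z = block M i j).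
  { intros i. destruct (classic (i < N M)%nat) as [Hi|Hi]; [|exists block_base; tauto].
    destruct (block_appears block_base M i 0 block_base_in Hi) as [t [_ Ht]].
    exists (fun m => block_base (m + t)%Z). intros _. split.
    - intros a n. destruct (block_base_in (a + t)%Z n) as [K [i' [p [H1 [H2 H3]]]]].
      exists K, i', p. split; auto. split; auto. intros j Hj. rewrite <- H3 by auto.
      f_equal. lia.
    - intros j Hj. rewrite <- Ht by auto. f_equal. lia. }
  apply choice in H. destruct H as [xi Hxi].
  exists (map xi (seq 0 (N M))). rewrite length_map, length_seq. split; [|split].
  - apply Rlt_le, num_exp_lt.
  - intros x Hx. apply in_map_iff in Hx. destruct Hx as [i [<- Hi]].
    apply in_seq in Hi. apply Hxi. lia.
  - rewrite map_map. apply NoDup_map_in; [apply seq_NoDup|].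
    intros i i' Hi Hi' E. apply in_seq in Hi. apply in_seq in Hi'.
    destruct (Nat.eq_dec i i') as [Heq|Hne]; auto. exfalso.
    destruct (block_inj M i i') as [p [Hp Hpn]]; try lia. apply Hpn.
    destruct (Hxi i) as [_ H1]; [lia|]. destruct (Hxi i') as [_ H2]; [lia|].
    rewrite <- H1, <- H2 by auto. unfold word in E.
    apply (ext_in_map E). apply in_seq. lia.
Qed.
End Blocks.

Lemma subshift_exists r : 0 <= r -> inhabited (subshift r).
Proof.
  intros Hr. destruct (block_params_exist r Hr) as [P]. constructor.
  refine {| pts := block_pts P; base := block_base P |}.
  - apply block_base_in.
  - intros x k Hx a n. destruct (Hx (a + k)%Z n) as [K [i [p [H1 [H2 H3]]]]].
    exists K, i, p. split; auto. split; auto. intros j Hj. rewrite <- H3 by auto.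
    f_equal. lia.
  - intros x H a n. destruct (H (Z.abs a + Z.of_nat n)%Z) as [y [Hy Hyx]].
    destruct (Hy a n) as [K [i [p [H1 [H2 H3]]]]].
    exists K, i, p. split; auto. split; auto. intros j Hj. rewrite <- H3 by auto.
    symmetry. apply Hyx. lia.
  - intros x y Q. apply block_recurrent.
  - intros t. apply (block_aperiodic P). apply block_base_in.
  - intros e He. apply block_words_le; auto.
  - apply block_words_ge.
Qed.

(** * The blow-up *)

(* The star with [d] legs, inside the union of the first [d] half-axes of [R^nat]. *)
Definition star (d : nat) (s : nat -> R) : Prop :=
  (forall i, 0 <= s i <= 1) /\ (forall i, (d <= i)%nat -> s i = 0) /\
  (forall i j, i <> j -> s i = 0 \/ s j = 0).

(** The retraction of the infinite star that collapses all legs from number [d] on to the centre. *)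
Definition trunc (d : nat) (s : nat -> R) (i : nat) : R :=
  if (i <? d)%nat then s i else 0.

Definition spoke (i : nat) (t : R) (j : nat) : R := if (j =? i)%nat then t else 0.

Lemma trunc_lt d s i : (i < d)%nat -> trunc d s i = s i.
Proof. intros H. unfold trunc. destruct (Nat.ltb_spec i d); auto. lia. Qed.

Lemma trunc_ge d s i : (d <= i)%nat -> trunc d s i = 0.
Proof. intros H. unfold trunc. destruct (Nat.ltb_spec i d); auto. lia. Qed.

Lemma trunc_star d s i : star d s -> trunc d s i = s i.
Proof.
  intros [_ [H _]]. unfold trunc. destruct (Nat.ltb_spec i d); auto. symmetry; auto.
Qed.

Lemma trunc_diff d s s' i : Rabs (trunc d s i - trunc d s' i) <= Rabs (s i - s' i).
Proof.
  unfold trunc. destruct (i <? d)%nat; [lra|].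
  rewrite Rminus_diag, Rabs_R0. apply Rabs_pos.
Qed.

Lemma star_trunc d d' s : star d' s -> star d (trunc d s).
Proof.
  intros [H1 [H2 H3]]. repeat split.
  - unfold trunc. destruct (i <? d)%nat; [apply H1|lra].
  - unfold trunc. destruct (i <? d)%nat; [apply H1|lra].
  - intros i Hi. apply trunc_ge; auto.
  - intros i j Hij. unfold trunc. destruct (i <? d)%nat, (j <? d)%nat; auto.
Qed.

Lemma star_spoke i t : 0 <= t <= 1 -> star (S i) (spoke i t).
Proof.
  intros Ht. unfold spoke. repeat split.
  - destruct (i0 =? i)%nat; lra.
  - destruct (i0 =? i)%nat; lra.
  - intros j Hj. destruct (Nat.eqb_spec j i); auto. lia.
  - intros j k Hjk. destruct (Nat.eqb_spec j i), (Nat.eqb_spec k i); auto. lia.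
Qed.

Lemma star_spoke_exists d s : star d s -> exists i, forall j, s j = spoke i (s i) j.
Proof.
  intros [_ [_ H]]. destruct (classic (exists i, s i <> 0)) as [[i Hi]|Hn].
  - exists i. intros j. unfold spoke. destruct (Nat.eqb_spec j i) as [->|Hj]; auto.
    destruct (H j i Hj); auto. contradiction.
  - exists 0%nat. intros j. unfold spoke. destruct (Nat.eqb_spec j 0) as [->|Hj]; auto.
    apply NNPP. eauto.
Qed.

Lemma Rabs_small_0 x : (forall e, 0 < e -> Rabs x <= e) -> x = 0.
Proof.
  intros H. apply NNPP. intros Hx. pose proof (Rabs_pos_lt x Hx).
  specialize (H (Rabs x / 2) ltac:(lra)). lra.
Qed.

(* Decoding [k] as [(i, (u, v))], the point at height [u / (v + 1)] on leg [i]; letting [v] grow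
   gives density of every tail of the sequence, see [star_seq_dense]. *)
Definition star_seq (k : nat) : nat -> R :=
  let (i, m) := of_nat k in let (u, v) := of_nat m in
  spoke i (Rmin 1 (INR u / INR (S v))).

Lemma star_star_seq d k : star d (trunc d (star_seq k)).
Proof.
  unfold star_seq. destruct (of_nat k) as [i m], (of_nat m) as [u v].
  apply star_trunc with (S i). apply star_spoke. split; [|apply Rmin_l].
  apply Rmin_glb; [lra|]. pose proof (pos_INR u).
  assert (0 < / INR (S v)) by (apply Rinv_0_lt_compat, lt_0_INR; lia).
  unfold Rdiv. nra.
Qed.

Lemma grid_approx t n : 0 <= t <= 1 -> (1 <= n)%nat ->
  exists a, (a < n)%nat /\ INR a / INR n <= t <= INR (S a) / INR n.
Proof.
  intros Ht Hn. assert (Hn0 : 0 < INR n) by (apply lt_0_INR; lia).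
  assert (H : forall k, t <= INR (S k) / INR n -> exists a, (a <= k)%nat /\
             INR a / INR n <= t <= INR (S a) / INR n).
  { induction k as [|k IH]; intros Hk.
    - exists 0%nat. split; auto. split; [|exact Hk].
      change (INR 0) with 0. unfold Rdiv. lra.
    - destruct (Rle_dec t (INR (S k) / INR n)) as [H|H].
      + destruct (IH H) as [a [Ha Hta]]. exists a. split; auto.
      + exists (S k). split; auto. lra. }
  destruct (H (pred n)) as [a [Ha Hta]].
  - replace (S (pred n)) with n by lia. unfold Rdiv. rewrite Rinv_r; lra.
  - exists a. split; [lia|auto].
Qed.

Lemma inv_INR_small e : 0 < e -> exists n, forall m, (n <= m)%nat -> / INR (S m) < e.
Proof.
  intros He. destruct (archimed_cor1 e He) as [n [Hn Hp]]. exists n. intros m Hm.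
  apply Rle_lt_trans with (/ INR n); auto.
  apply Rinv_le_contravar; [apply lt_0_INR; auto|apply le_INR; lia].
Qed.

Lemma star_seq_dense d s e K : star d s -> 0 < e -> exists k, (K <= k)%nat /\
  forall i, Rabs (trunc d (star_seq k) i - s i) <= e.
Proof.
  intros Hs He. destruct (star_spoke_exists d s Hs) as [i Hi].
  destruct (inv_INR_small e He) as [n0 Hn0].
  (* A large denominator both refines the grid and pushes the code past [K], as pairing dominates
     its arguments. *)
  set (v := max K n0). specialize (Hn0 v ltac:(lia)).
  destruct Hs as [Hs1 Hs2]. 
  destruct (grid_approx (s i) (S v) (Hs1 i) ltac:(lia)) as [u [Hu Htu]].
  exists (to_nat (i, to_nat (u, v))). split.
  - pose proof (to_nat_non_decreasing i (to_nat (u, v))).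
    pose proof (to_nat_non_decreasing u v). lia.
  - intros j. rewrite <- (trunc_star d s j) by (split; auto).
    apply Rle_trans with (1 := trunc_diff _ _ _ _).
    unfold star_seq. rewrite !cancel_of_to, Hi. unfold spoke.
    destruct (j =? i)%nat; [|rewrite Rminus_diag, Rabs_R0; lra].
    pose proof (Hs1 i). rewrite Rmin_right by lra.
    rewrite (S_INR u) in Htu. unfold Rdiv in *.
    rewrite Rmult_plus_distr_r, Rmult_1_l in Htu.
    apply Rabs_le. lra.
Qed.

(** The explicit rate is the point: applied to star coordinates it is independent of the leg, so
    limits are uniform over the legs. *)
Lemma cauchy_half_limit (a : nat -> R) K : 0 <= K ->
  (forall n m, (n <= m)%nat -> Rabs (a n - a m) <= K * (/2)^n) ->
  exists l, forall n, Rabs (a n - l) <= K * (/2)^n.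
Proof.
  intros HK H.
  assert (Hjk : forall j k, a j - K * (/2)^j <= a k + K * (/2)^k).
  { intros j k. pose proof (half_pow_pos j). pose proof (half_pow_pos k).
    assert (0 <= K * (/2)^k /\ 0 <= K * (/2)^j) by nra.
    destruct (le_lt_dec j k) as [Hl|Hl].
    - specialize (H j k Hl). pose proof (Rle_abs (a j - a k)). lra.
    - specialize (H k j ltac:(lia)). pose proof (Rle_abs (- (a k - a j))).
      rewrite Rabs_Ropp in *. lra. }
  destruct (completeness (fun y => exists j, y = a j - K * (/2)^j)) as [l [Hub Hl]].
  - exists (a 0%nat + K * (/2)^0). intros y [j ->]. auto.
  - eexists. exists 0%nat. reflexivity.
  - exists l. intros n. apply Rabs_le. split.
    + assert (l <= a n + K * (/2)^n); [|lra]. apply Hl. intros y [j ->]. auto.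
    + assert (a n - K * (/2)^n <= l); [|lra]. apply Hub. eauto.
Qed.

Definition shift (k : Z) (x : Z -> nat) : Z -> nat := fun m => x (m + k)%Z.

(* The classes of [linked] are the quasi-components. *)
Definition linked {X : MetricSpace} (z w : X) : Prop :=
  forall U : X -> Prop, is_open U -> is_open (fun x => ~ U x) -> U z -> U w.

Lemma open_preimage {X Y : MetricSpace} (f : X -> Y) U :
  continuous f -> is_open U -> is_open (fun x => U (f x)).
Proof.
  intros Hf HU x Hx. destruct (HU _ Hx) as [e [He Hb]].
  destruct (Hf x e He) as [d [Hd Hc]]. exists d. auto.
Qed.

Lemma linked_image {X Y : MetricSpace} (f : X -> Y) z w :
  continuous f -> linked z w -> linked (f z) (f w).
Proof.
  intros Hf H U HU HU'. apply (H (fun x => U (f x))).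
  - apply open_preimage; auto.
  - apply (open_preimage f (fun y => ~ U y)); auto.
Qed.

(* [F] minus one of its points splits into at least [m] relatively open parts,
   namely the level sets of [col]. *)
Definition branches {X : MetricSpace} (F : X -> Prop) (m : nat) : Prop :=
  exists (p : X) (col : X -> nat), F p /\
    (forall z, F z -> z <> p -> exists e, 0 < e /\
       forall w, F w -> w <> p -> dist z w < e -> col w = col z) /\
    forall i, (i < m)%nat -> exists z, F z /\ z <> p /\ col z = i.

Lemma branches_homeo {X Y : MetricSpace} (f : X -> Y) g z m :
  is_homeo f g -> branches (linked z) m -> branches (linked (f z)) m.
Proof.
  intros [Hf [Hg [Hgf Hfg]]] [p [col [Hp [Hloc Hsurj]]]].
  assert (Hl : forall w, linked (f z) w -> linked z (g w)).
  { intros w Hw. rewrite <- (Hgf z). apply linked_image; auto. }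
  assert (Hne : forall w, w <> f p -> g w <> p).
  { intros w Hw E. apply Hw. rewrite <- E. auto. }
  exists (f p), (fun w => col (g w)). split; [|split].
  - apply linked_image; auto.
  - intros w Hw Hwp. destruct (Hloc (g w)) as [e [He Hc]]; auto.
    destruct (Hg w e He) as [d [Hd Hd']]. exists d. auto.
  - intros i Hi. destruct (Hsurj i Hi) as [w [Hw [Hwp E]]]. exists (f w).
    split; [apply linked_image; auto|]. rewrite Hgf. split; auto.
    intros E'. apply Hwp. rewrite <- (Hgf w), E'. auto.
Qed.

(** Lets a point on a leg be built from any real parameter, without a range proof as argument. *)
Definition clip (t : R) : R := Rmax 0 (Rmin 1 t).

Lemma clip_bounds t : 0 <= clip t <= 1.
Proof. unfold clip, Rmax, Rmin. destruct (Rle_dec 1 t), Rle_dec; lra. Qed.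

Lemma clip_id t : 0 <= t <= 1 -> clip t = t.
Proof. intros H. unfold clip, Rmax, Rmin. destruct (Rle_dec 1 t), Rle_dec; lra. Qed.

Lemma clip_lipschitz t t' : Rabs (clip t - clip t') <= Rabs (t - t').
Proof.
  unfold clip, Rmax, Rmin, Rabs.
  destruct (Rle_dec 1 t), (Rle_dec 1 t'); repeat destruct Rle_dec; repeat destruct Rcase_abs; lra.
Qed.

Section Blowup.
Context {r : R} (B : subshift r) (b : nat -> bool).
Notation C := (pts r B).
Notation c := (base r B).

Definition agree (q : nat) (x : Z -> nat) : Prop :=
  forall m, (Z.abs m < Z.of_nat q)%Z -> x m = c m.

(** The rings are clopen annuli that partition the complement of [c]; membership in ring [q] is
    decided by the coordinates up to [q]. *)
Definition ring (q : nat) (x : Z -> nat) : Prop := agree q x /\ ~ agree (S q) x.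

Lemma agree_mono q q' x : (q <= q')%nat -> agree q' x -> agree q x.
Proof. intros Hq H m Hm. apply H. lia. Qed.

Lemma ring_unique q q' x : ring q x -> ring q' x -> q = q'.
Proof.
  intros [H1 H2] [H3 H4]. destruct (lt_eq_lt_dec q q') as [[H|H]|H]; auto; exfalso.
  - apply H2. apply agree_mono with q'; auto.
  - apply H4. apply agree_mono with q; auto.
Qed.

Lemma ring_ext q x y : (forall m, (Z.abs m <= Z.of_nat q)%Z -> y m = x m) ->
  ring q x -> ring q y.
Proof.
  intros H [H1 H2]. split.
  - intros m Hm. rewrite H by lia. auto.
  - intros Hy. apply H2. intros m Hm. rewrite <- H by lia. auto.
Qed.

Lemma ring_below q x : ~ agree q x -> exists p, (p < q)%nat /\ ring p x.
Proof.
  intros H. induction q as [|q IH].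
  - exfalso. apply H. intros m Hm. lia.
  - destruct (classic (agree q x)) as [Hq|Hq].
    + exists q. split; auto. split; auto.
    + destruct (IH Hq) as [p [Hp Hr]]. exists p. auto.
Qed.

Lemma ring_or_base x : (exists q, ring q x) \/ forall m, x m = c m.
Proof.
  destruct (classic (forall q, agree q x)) as [H|H].
  - right. intros m. apply (H (S (Z.abs_nat m))). lia.
  - left. apply not_all_ex_not in H. destruct H as [q Hq].
    destruct (ring_below q x Hq) as [p [_ Hp]]. eauto.
Qed.

Lemma ring_not_base q x : ring q x -> ~ forall m, x m = c m.
Proof. intros [_ H] Hx. apply H. intros m _. auto. Qed.

(** Consequently at most one star coordinate of a point is free. *)
Lemma shift_base_twice (x : Z -> nat) (k k' : Z) :
  (forall m, x (m + k)%Z = c m) -> (forall m, x (m + k')%Z = c m) -> k = k'.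
Proof.
  intros H H'. destruct (Z.eq_dec k k') as [E|E]; auto. exfalso.
  destruct (aperiodic r B (k' - k)%Z) as [m Hm]; [lia|]. apply Hm.
  rewrite <- H, <- H'. f_equal. lia.
Qed.

Definition inhabited_ring (q : nat) : Prop := exists w, C w /\ ring q w.

Lemma inhabited_ring_unbounded K : exists q, (K <= q)%nat /\ inhabited_ring q.
Proof.
  destruct (recurrent r B c c (Z.of_nat K) (base_in r B) (base_in r B)) as [G HG].
  destruct (HG 1%Z) as [t [Ht Hm]].
  destruct (ring_or_base (shift t c)) as [[q Hq]|H].
  - exists q. split; [|exists (shift t c); split; auto; apply shift_in, base_in].
    destruct (le_lt_dec K q) as [|Hl]; auto. exfalso. apply (proj2 Hq).
    apply agree_mono with K; auto.
  - exfalso. destruct (aperiodic r B t) as [m Hm']; [lia|]. apply Hm', H.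
Qed.

(* Numbers the nonempty rings consecutively: some rings may be empty, and the values of a
   sequence indexed by [rank] are nevertheless all attained. *)
Fixpoint rank (q : nat) : nat :=
  match q with
  | O => O
  | S q => if excluded_middle_informative (inhabited_ring q) then S (rank q) else rank q
  end.

Lemma rank_le q : (rank q <= q)%nat.
Proof. induction q; simpl; auto. destruct excluded_middle_informative; lia. Qed.

Lemma rank_next q : exists p, (q <= p)%nat /\ inhabited_ring p /\ rank p = rank q.
Proof.
  destruct (inhabited_ring_unbounded q) as [p [Hp Hin]].
  replace p with (q + (p - q))%nat in Hin by lia. revert Hin.
  generalize (p - q)%nat as d. clear Hp p. intros d. revert q.
  induction d as [|d IH]; intros q Hin.
  - rewrite Nat.add_0_r in Hin. eauto.
  - destruct (classic (inhabited_ring q)) as [H|H]; [eauto|].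
    destruct (IH (S q)) as [p [Hp [Hp1 Hp2]]].
    + replace (S q + d)%nat with (q + S d)%nat by lia. auto.
    + exists p. split; [lia|]. split; auto. rewrite Hp2. simpl.
      destruct excluded_middle_informative; [contradiction|auto].
Qed.

Lemma rank_onto k : exists q, inhabited_ring q /\ rank q = k.
Proof.
  induction k as [|k [q [Hq E]]].
  - destruct (rank_next 0) as [p [_ H]]. exists p. exact H.
  - destruct (rank_next (S q)) as [p [_ [H1 H2]]]. exists p. split; auto.
    rewrite H2. simpl. destruct excluded_middle_informative; [auto|contradiction].
Qed.

(* Strictly increasing for every [b], and [b] can be read off from the set of values. *)
Definition legs (n : nat) : nat := (2 * n + 3 + (if b n then 1 else 0))%nat.

Lemma legs_lt n n' : (n < n')%nat -> (legs n < legs n')%nat.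
Proof. unfold legs. destruct (b n), (b n'); lia. Qed.

(** All coordinates truncate one common sequence, so truncating the value for [n + 1] to [legs n]
    legs gives the value for [n]; this keeps the image under [step] inside the blow-up. *)
Definition ring_value (n q : nat) : nat -> R := trunc (legs n) (star_seq (rank q)).

Definition over (x : Z -> nat) (n : nat) : Prop := forall m, x (m + Z.of_nat n)%Z = c m.

(* A point is a sequence [x] of the subshift with star points [s n]; [s n] is forced by the ring
   containing [T^n x] and is free exactly when [T^n x = c]. *)
Definition in_blowup (z : (Z -> nat) * (nat -> nat -> R)) : Prop :=
  C (fst z) /\ (forall n, star (legs n) (snd z n)) /\
  forall n q, ring q (shift (Z.of_nat n) (fst z)) -> forall i, snd z n i = ring_value n q i.

Definition pt : Type := {z | in_blowup z}.
Definition bs (z : pt) : Z -> nat := fst (proj1_sig z).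
Definition sp (z : pt) : nat -> nat -> R := snd (proj1_sig z).

Lemma bs_in z : C (bs z).
Proof. apply (proj2_sig z). Qed.

Lemma sp_star z n : star (legs n) (sp z n).
Proof. apply (proj2_sig z). Qed.

Lemma sp_ring z n q i : ring q (shift (Z.of_nat n) (bs z)) -> sp z n i = ring_value n q i.
Proof. intros H. apply (proj2_sig z). exact H. Qed.

Lemma pt_ext z z' : (forall m, bs z m = bs z' m) -> (forall n i, sp z n i = sp z' n i) -> z = z'.
Proof.
  destruct z as [[x s] H], z' as [[x' s'] H']. unfold bs, sp. simpl. intros E1 E2.
  assert (x = x') as -> by (apply functional_extensionality; auto).
  assert (s = s') as -> by (do 2 (apply functional_extensionality; intros); auto).
  f_equal. apply proof_irrelevance.
Qed.

(** The weight of a star coordinate depends on [n] only: each star is measured in the sup norm over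
    its legs. *)
Definition gap (a : Z + nat * nat) (z z' : pt) : R :=
  match a with
  | inl m => if Nat.eq_dec (bs z m) (bs z' m) then 0 else (/2)^(Z.abs_nat m)
  | inr (n, i) => (/2)^n * Rabs (sp z n i - sp z' n i)
  end.

Lemma sp_diff_le1 z z' n i : Rabs (sp z n i - sp z' n i) <= 1.
Proof.
  destruct (sp_star z n) as [H _], (sp_star z' n) as [H' _].
  specialize (H i). specialize (H' i). apply Rabs_le. lra.
Qed.

Definition space : MetricSpace.
Proof.
  refine (sup_metric pt (Z + nat * nat) (inl 0%Z) gap _ _ _ _ _ _).
  - intros [m|[n i]] z z'; simpl.
    + destruct Nat.eq_dec; [lra|]. apply Rlt_le, half_pow_pos.
    + apply Rmult_le_pos; [apply Rlt_le, half_pow_pos|apply Rabs_pos].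
  - intros [m|[n i]] z z'; simpl.
    + destruct Nat.eq_dec; [lra|]. apply half_pow_le1.
    + pose proof (half_pow_le1 n). pose proof (half_pow_pos n).
      pose proof (sp_diff_le1 z z' n i). pose proof (Rabs_pos (sp z n i - sp z' n i)). nra.
  - intros [m|[n i]] z; simpl.
    + destruct Nat.eq_dec; [auto|contradiction].
    + rewrite Rminus_diag, Rabs_R0. ring.
  - intros [m|[n i]] z z'; simpl.
    + destruct (Nat.eq_dec (bs z m)), (Nat.eq_dec (bs z' m)); congruence.
    + rewrite Rabs_minus_sym. reflexivity.
  - intros [m|[n i]] z z' z''; simpl.
    + pose proof (half_pow_pos (Z.abs_nat m)).
      destruct (Nat.eq_dec (bs z m) (bs z'' m)), (Nat.eq_dec (bs z m) (bs z' m)),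
        (Nat.eq_dec (bs z' m) (bs z'' m)); try lra. congruence.
    + rewrite <- Rmult_plus_distr_l. apply Rmult_le_compat_l; [apply Rlt_le, half_pow_pos|].
      replace (sp z n i - sp z'' n i) with ((sp z n i - sp z' n i) + (sp z' n i - sp z'' n i)) by ring.
      apply Rabs_triang.
  - intros z z' H. apply pt_ext.
    + intros m. specialize (H (inl m)). simpl in H. destruct Nat.eq_dec; auto.
      pose proof (half_pow_pos (Z.abs_nat m)). lra.
    + intros n i. specialize (H (inr (n, i))). simpl in H. pose proof (half_pow_pos n).
      apply Rmult_integral in H. destruct H as [H|H]; [lra|].
      apply Rminus_diag_uniq. destruct (Req_dec (sp z n i - sp z' n i) 0); auto.
      apply Rabs_no_R0 in H1. contradiction.
Defined.

Lemma dist_le (z z' : space) e : 0 <= e ->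
  dist z z' <= e <->
  (forall m, bs z m <> bs z' m -> (/2)^(Z.abs_nat m) <= e) /\
  (forall n i, (/2)^n * Rabs (sp z n i - sp z' n i) <= e).
Proof.
  intros He. etransitivity; [apply sup_metric_le|]. split.
  - intros H. split.
    + intros m Hm. specialize (H (inl m)). simpl in H. destruct Nat.eq_dec; [contradiction|auto].
    + intros n i. apply (H (inr (n, i))).
  - intros [H1 H2] [m|[n i]]; simpl; auto. destruct Nat.eq_dec; auto.
Qed.

Lemma dist_le1 (z z' : space) : dist z z' <= 1.
Proof.
  apply dist_le; [lra|]. split; intros.
  - apply half_pow_le1.
  - pose proof (half_pow_le1 n). pose proof (half_pow_pos n).
    pose proof (sp_diff_le1 z z' n i). pose proof (Rabs_pos (sp z n i - sp z' n i)). nra.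
Qed.

Lemma bs_dist (z z' : space) m : bs z m <> bs z' m -> (/2)^(Z.abs_nat m) <= dist z z'.
Proof.
  apply (proj1 (dist_le z z' _ (dist_nonneg _ z z')) (Rle_refl _)).
Qed.

Lemma bs_close (z z' : space) m : dist z z' < (/2)^(Z.abs_nat m) -> bs z m = bs z' m.
Proof.
  intros H. apply NNPP. intros Hn. apply bs_dist in Hn. lra.
Qed.

Lemma sp_dist (z z' : space) n i : (/2)^n * Rabs (sp z n i - sp z' n i) <= dist z z'.
Proof.
  apply (proj1 (dist_le z z' _ (dist_nonneg _ z z')) (Rle_refl _)).
Qed.

Lemma dist_le_window (z z' : space) M e : (/2)^M <= e ->
  (forall m, (Z.abs m < Z.of_nat M)%Z -> bs z m = bs z' m) ->
  (forall n i, (n < M)%nat -> Rabs (sp z n i - sp z' n i) <= e) ->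
  dist z z' <= e.
Proof.
  intros HM H1 H2. pose proof (half_pow_pos M). apply dist_le; [lra|]. split.
  - intros m Hm. apply Rle_trans with ((/2)^M); auto. apply half_pow_anti.
    destruct (Z_lt_le_dec (Z.abs m) (Z.of_nat M)) as [Hl|Hl]; [|lia].
    exfalso. auto.
  - intros n i. pose proof (half_pow_pos n). pose proof (Rabs_pos (sp z n i - sp z' n i)).
    destruct (le_lt_dec M n) as [Hl|Hl].
    + apply half_pow_anti in Hl. pose proof (sp_diff_le1 z z' n i). nra.
    + specialize (H2 n i Hl). pose proof (half_pow_le1 n). nra.
Qed.

Lemma lift_exists x : C x -> exists z : space, forall m, bs z m = x m.
Proof.
  intros Hx.
  (* Without a ring the coordinate is free, and the first term of the sequence serves as default. *)
  set (s := fun n => match excluded_middle_informative (exists q, ring q (shift (Z.of_nat n) x)) with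
                     | left H => ring_value n (proj1_sig (constructive_indefinite_description _ H))
                     | right _ => trunc (legs n) (star_seq 0)
                     end).
  assert (H : in_blowup (x, s)).
  { split; [exact Hx|]. split; simpl.
    - intros n. unfold s. destruct excluded_middle_informative; apply star_star_seq.
    - intros n q Hq i. unfold s. destruct excluded_middle_informative as [H|H].
      + destruct constructive_indefinite_description as [q' Hq']. simpl.
        rewrite (ring_unique q' q _ Hq' Hq). reflexivity.
      + exfalso. eauto. }
  exists (exist in_blowup (x, s) H). reflexivity.
Qed.

(** Base coordinates stabilise and star coordinates converge uniformly over the legs. The ring
    condition passes to the limit because it involves a finite window, on which the base sequences
    are eventually equal to the limit. *)
Lemma space_complete : complete space.
Proof.
  intros u Hu.
  (* With [k >= |m| + 2] the modulus [2 * (/2)^k] is below [(/2)^|m|], the distance forced by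
     different letters at [m]. *)
  assert (Hb : forall m k k', (Z.abs_nat m + 2 <= k)%nat -> (Z.abs_nat m + 2 <= k')%nat ->
             bs (u k) m = bs (u k') m).
  { assert (H : forall m k k', (Z.abs_nat m + 2 <= k)%nat -> (k <= k')%nat ->
                bs (u k) m = bs (u k') m).
    { intros m k k' Hk Hkk. apply bs_close. apply Rle_lt_trans with (1 := Hu k k' Hkk).
      apply half_pow_anti in Hk. rewrite pow_add in Hk. simpl in Hk.
      pose proof (half_pow_pos (Z.abs_nat m)). lra. }
    intros m k k' Hk Hk'. destruct (le_lt_dec k k'); [apply H; auto|].
    symmetry. apply H; auto. lia. }
  assert (Hs : forall p : nat * nat, exists l, forall k,
             Rabs (sp (u k) (fst p) (snd p) - l) <= 2 * 2^(fst p) * (/2)^k).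
  { intros [n i]. simpl. assert (0 < 2^n) by (apply pow_lt; lra).
    apply cauchy_half_limit; [lra|]. intros k k' Hk.
    pose proof (sp_dist (u k) (u k') n i) as H1. specialize (Hu k k' Hk).
    rewrite pow_inv in H1. apply Rmult_le_compat_l with (r := 2^n) in H1; [|lra].
    rewrite <- Rmult_assoc, Rinv_r, Rmult_1_l in H1 by lra. nra. }
  apply choice in Hs. destruct Hs as [s0 Hs0].
  set (s := fun n i => s0 (n, i)). set (x := fun m => bs (u (Z.abs_nat m + 2)%nat) m).
  assert (Hs : forall n i k, Rabs (sp (u k) n i - s n i) <= 2 * 2^n * (/2)^k).
  { intros n i. apply (Hs0 (n, i)). }
  assert (Hx : forall m k, (Z.abs_nat m + 2 <= k)%nat -> bs (u k) m = x m).
  { intros m k Hk. apply Hb; auto. }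
  assert (Hlim : forall n e K, 0 < e -> exists k, (K <= k)%nat /\
             forall i, Rabs (sp (u k) n i - s n i) <= e).
  { intros n e K He. assert (0 < 2^n) by (apply pow_lt; lra).
    destruct (half_pow_small (e / (2 * 2^n))) as [k0 Hk0].
    { apply Rdiv_lt_0_compat; lra. }
    exists (max K k0). split; [lia|]. intros i. apply Rle_trans with (1 := Hs n i _).
    apply Rle_trans with (2 * 2^n * (/2)^k0).
    - apply Rmult_le_compat_l; [lra|]. apply half_pow_anti. lia.
    - apply Rmult_le_reg_l with (/ (2 * 2^n)); [apply Rinv_0_lt_compat; lra|].
      rewrite <- Rmult_assoc, Rinv_l, Rmult_1_l by lra. unfold Rdiv in Hk0. lra. }
  assert (Hblow : in_blowup (x, s)).
  { split; [|split]; simpl.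
    - apply pts_closed. intros Q. exists (bs (u (Z.to_nat Q + 2)%nat)).
      split; [apply bs_in|]. intros m Hm. apply Hx. lia.
    - intros n. split; [|split].
      + intros i. split; apply le_epsilon; intros e He;
          destruct (Hlim n e 0%nat He) as [k [_ Hk]]; specialize (Hk i);
          apply Rabs_le_between in Hk; destruct (sp_star (u k) n) as [H _]; specialize (H i); lra.
      + intros i Hi. apply Rabs_small_0. intros e He.
        destruct (Hlim n e 0%nat He) as [k [_ Hk]]. specialize (Hk i).
        destruct (sp_star (u k) n) as [_ [H _]]. rewrite H in Hk by auto.
        rewrite Rminus_0_l, Rabs_Ropp in Hk. exact Hk.
      + intros i j Hij. apply NNPP. intros Hn. apply not_or_and in Hn. destruct Hn as [Hi Hj].
        apply Rabs_pos_lt in Hi. apply Rabs_pos_lt in Hj.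
        set (e := Rmin (Rabs (s n i)) (Rabs (s n j)) / 2).
        assert (He : 0 < e < Rabs (s n i) /\ e < Rabs (s n j)).
        { unfold e, Rmin. destruct Rle_dec; lra. }
        destruct (Hlim n e 0%nat ltac:(lra)) as [k [_ Hk]].
        destruct (sp_star (u k) n) as [_ [_ H]].
        destruct (H i j Hij) as [H0|H0]; [specialize (Hk i)|specialize (Hk j)];
          rewrite H0, Rminus_0_l, Rabs_Ropp in Hk; lra.
    - intros n q Hq i. apply Rminus_diag_uniq, Rabs_small_0. intros e He.
      destruct (Hlim n e (q + n + 2)%nat He) as [k [HK Hk]].
      rewrite <- (sp_ring (u k)), Rabs_minus_sym; auto.
      apply ring_ext with (2 := Hq). intros m Hm. unfold shift. apply Hx. lia. }
  exists (exist in_blowup (x, s) Hblow). intros e He.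
  destruct (half_pow_small (e / 2)) as [N HN]; [lra|]. exists N. intros k Hk.
  apply Rle_lt_trans with (2 * (/2)^k); [|apply half_pow_anti in Hk; lra].
  pose proof (half_pow_pos k). apply dist_le; [lra|]. split.
  - intros m Hm. set (K := max k (Z.abs_nat m + 2)%nat).
    apply Rle_trans with (dist (u k) (u K)); [|apply Hu; lia].
    apply bs_dist. intros E. apply Hm. rewrite E. apply Hx. lia.
  - intros n i. change (sp (exist in_blowup (x, s) Hblow) n i) with (s n i).
    pose proof (half_pow_pos n). apply Rle_trans with ((/2)^n * (2 * 2^n * (/2)^k)).
    + apply Rmult_le_compat_l; auto. lra.
    + rewrite (pow_inv 2 n). replace (/ 2^n * (2 * 2^n * (/2)^k)) with (2 * (/2)^k); [lra|].
      field. apply pow_nonzero. lra.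
Qed.

Lemma legs_mono n n' : (n <= n')%nat -> (legs n <= legs n')%nat.
Proof.
  intros H. destruct (Nat.eq_dec n n') as [->|]; auto.
  apply Nat.lt_le_incl, legs_lt. lia.
Qed.

(** * The map over the shift and its minimality *)

Lemma step_blow (z : pt) :
  in_blowup (shift 1 (bs z), fun n => trunc (legs n) (sp z (S n))).
Proof.
  split; [apply shift_in, bs_in|]. split; simpl.
  - intros n. apply star_trunc with (legs (S n)), sp_star.
  - intros n q Hq i. unfold trunc at 1, ring_value, trunc.
    destruct (Nat.ltb_spec i (legs n)) as [Hi|Hi]; auto.
    rewrite (sp_ring z (S n) q).
    + apply trunc_lt. pose proof (legs_lt n (S n)). lia.
    + apply ring_ext with (2 := Hq). intros m Hm. unfold shift. f_equal. lia.
Qed.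

Definition step (z : space) : space := exist in_blowup _ (step_blow z).

Lemma bs_iter k z m : bs (Nat.iter k step z) m = bs z (m + Z.of_nat k)%Z.
Proof.
  revert m. induction k as [|k IH]; intros m.
  - simpl. f_equal. lia.
  - change (bs (Nat.iter (S k) step z) m) with (bs (Nat.iter k step z) (m + 1)%Z).
    rewrite IH. f_equal. lia.
Qed.

Lemma sp_iter k z n i : sp (Nat.iter k step z) n i = trunc (legs n) (sp z (n + k)%nat) i.
Proof.
  revert n. induction k as [|k IH]; intros n.
  - rewrite Nat.add_0_r, trunc_star; auto. apply sp_star.
  - change (sp (Nat.iter (S k) step z) n i)
      with (trunc (legs n) (sp (Nat.iter k step z) (S n)) i).
    replace (n + S k)%nat with (S n + k)%nat by lia.
    unfold trunc. destruct (Nat.ltb_spec i (legs n)) as [Hi|Hi]; auto.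
    rewrite IH. apply trunc_lt. pose proof (legs_lt n (S n)). lia.
Qed.

(** The map is 2-Lipschitz: every coordinate moves by one place, which at most doubles its weight,
    and truncation does not expand. *)
Lemma step_continuous : continuous step.
Proof.
  intros z e He. exists (e / 4). split; [lra|]. intros z' Hz.
  apply Rle_lt_trans with (2 * dist z z'); [|lra].
  pose proof (dist_nonneg _ z z'). apply dist_le; [lra|]. split.
  - intros m Hm. apply (bs_dist z z' (m + 1)) in Hm.
    assert (H1 : (Z.abs_nat (m + 1) <= S (Z.abs_nat m))%nat) by lia.
    apply half_pow_anti in H1. rewrite <- tech_pow_Rmult in H1. lra.
  - intros n i. pose proof (sp_dist z z' (S n) i) as H1. rewrite <- tech_pow_Rmult in H1.
    pose proof (half_pow_pos n).
    pose proof (trunc_diff (legs n) (sp z (S n)) (sp z' (S n)) i) as H2.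
    change (sp (step z) n i) with (trunc (legs n) (sp z (S n)) i).
    change (sp (step z') n i) with (trunc (legs n) (sp z' (S n)) i).
    apply Rmult_le_compat_l with (r := (/2)^n) in H2; lra.
Qed.

Lemma bounded_witnesses (P : nat -> nat -> Prop) M :
  (forall n, (n < M)%nat -> exists q, P n q) ->
  exists Q, forall n, (n < M)%nat -> exists q, (q <= Q)%nat /\ P n q.
Proof.
  induction M as [|M IH]; intros H.
  - exists 0%nat. intros n Hn. lia.
  - destruct IH as [Q HQ]; [auto|]. destruct (H M) as [q Hq]; auto.
    exists (max Q q). intros n Hn. destruct (Nat.eq_dec n M) as [->|Hne].
    + exists q. split; [lia|auto].
    + destruct (HQ n) as [p [Hp HP]]; [lia|]. exists p. split; [lia|auto].
Qed.

(** Every ball contains the full preimage of a nonempty cylinder, which reduces density in the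
    blow-up to [recurrent]. If [T^n z = c] with [n] in the relevant range, the cylinder is placed in
    a far ring around [c], shifted back by [n], whose prescribed star value approximates the free
    coordinate of [z]. *)
Lemma cylinder_in_ball (z : space) e : 0 < e -> exists y Q, C y /\
  forall z' : space, (forall m, (Z.abs m < Q)%Z -> bs z' m = y m) -> dist z z' <= e.
Proof.
  intros He. destruct (half_pow_small e He) as [M HM].
  destruct (classic (exists n, (n < M)%nat /\ over (bs z) n)) as [[n [Hn Hover]]|Hno].
  - destruct (bounded_witnesses
      (fun n' q => n' <> n -> ring q (shift (Z.of_nat n') (bs z))) M) as [Q0 HQ0].
    { intros n' Hn'. destruct (ring_or_base (shift (Z.of_nat n') (bs z))) as [[q Hq]|H]; [eauto|].
      exists 0%nat. intros Hne. exfalso. apply Hne, Nat2Z.inj.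
      apply (shift_base_twice (bs z)); auto. }
    (* As [rank q <= q], the bound on [k] makes the ring [q] so far out that the cylinder agrees
       with [z] wherever the rings of the other coordinates below [M] are decided. *)
    destruct (star_seq_dense (legs n) (sp z n) e (Q0 + 3 * M) (sp_star z n) He) as [k [Hk Hd]].
    destruct (rank_onto k) as [q [[w [Hw Hq]] Hr]]. pose proof (rank_le q).
    exists (shift (- Z.of_nat n) w), (Z.of_nat (q + 1 + 2 * M)). split; [apply shift_in; auto|].
    intros z' Hz'. unfold shift in Hz'.
    assert (Hbs : forall m, (Z.abs m < Z.of_nat (q - M))%Z -> bs z m = bs z' m).
    { intros m Hm. rewrite Hz' by lia. rewrite (proj1 Hq) by lia.
      rewrite <- Hover. f_equal. lia. }
    apply dist_le_window with M; [lra| |].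
    + intros m Hm. apply Hbs. lia.
    + intros n' i Hn'. destruct (Nat.eq_dec n' n) as [->|Hne].
      * rewrite (sp_ring z' n q).
        -- rewrite Rabs_minus_sym. unfold ring_value. rewrite Hr. apply Hd.
        -- apply ring_ext with (2 := Hq). intros m Hm. unfold shift.
           rewrite Hz' by lia. f_equal. lia.
      * destruct (HQ0 n' Hn') as [q' [Hq' Hrq]]. specialize (Hrq Hne).
        rewrite (sp_ring z n' q'), (sp_ring z' n' q'), Rminus_diag, Rabs_R0; auto; [lra|].
        apply ring_ext with (2 := Hrq). intros m Hm. unfold shift. symmetry. apply Hbs. lia.
  - destruct (bounded_witnesses (fun n q => ring q (shift (Z.of_nat n) (bs z))) M) as [Q0 HQ0].
    { intros n Hn. destruct (ring_or_base (shift (Z.of_nat n) (bs z))) as [H|H]; auto.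
      exfalso. apply Hno. eauto. }
    exists (bs z), (Z.of_nat (Q0 + M + 1)). split; [apply bs_in|]. intros z' Hz'.
    apply dist_le_window with M; [lra| |].
    + intros m Hm. symmetry. apply Hz'. lia.
    + intros n i Hn. destruct (HQ0 n Hn) as [q [Hq Hrq]].
      rewrite (sp_ring z n q), (sp_ring z' n q), Rminus_diag, Rabs_R0; auto; [lra|].
      apply ring_ext with (2 := Hrq). intros m Hm. unfold shift. apply Hz'. lia.
Qed.

Lemma step_minimal : minimal_map step.
Proof.
  split; [apply step_continuous|]. intros z z' e He.
  destruct (cylinder_in_ball z' (e/2)) as [y [Q [Hy HQ]]]; [lra|].
  destruct (recurrent r B (bs z) y Q (bs_in z) Hy) as [G HG].
  destruct (HG 0%Z) as [t [Ht Hm]]. exists (Z.to_nat t).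
  apply Rle_lt_trans with (e/2); [|lra]. rewrite dist_sym. apply HQ.
  intros m Hmq. rewrite bs_iter, Z2Nat.id by lia. auto.
Qed.

(** * Entropy *)

Definition visit (Q l : nat) (z : space) : Prop := agree Q (shift (Z.of_nat l) (bs z)).

(** By aperiodicity [c] differs from each of its shifts by [1, ..., G] inside a bounded window, so
    two visits to a smaller neighbourhood of [c] cannot be that close in time. *)
Lemma visits_sparse G : exists Q, forall z i j, (i < j)%nat ->
  visit Q i z -> visit Q j z -> (i + G < j)%nat.
Proof.
  destruct (bounded_witnesses (fun g q => (0 < g)%nat -> exists m,
     (Z.abs m <= Z.of_nat q)%Z /\ c (m + Z.of_nat g)%Z <> c m) (S G)) as [Q0 HQ0].
  { intros [|g] _.
    - exists 0%nat. lia.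
    - destruct (aperiodic r B (Z.of_nat (S g))) as [m Hm]; [lia|].
      exists (Z.abs_nat m). intros _. exists m. split; [lia|auto]. }
  exists (Q0 + G + 1)%nat. intros z i j Hij Hi Hj.
  destruct (le_lt_dec j (i + G)) as [Hl|]; auto. exfalso.
  destruct (HQ0 (j - i)%nat ltac:(lia)) as [q [Hq H]].
  destruct (H ltac:(lia)) as [m [Hmq Hm]]. apply Hm.
  rewrite <- (Hi (m + Z.of_nat (j - i))%Z), <- (Hj m) by lia.
  unfold shift. f_equal. lia.
Qed.

(** [k] encodes the leg [k / E] and the height interval [k mod E]. Cells share endpoints and the
    centre, hence a relation; legs from [D] on are ignored. *)
Definition cell (D E : nat) (s : nat -> R) (k : nat) : Prop :=
  (k < D * E)%nat /\ (forall j, j <> (k / E)%nat -> (j < D)%nat -> s j = 0) /\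
  INR (k mod E) / INR E <= s (k / E)%nat <= INR (S (k mod E)) / INR E.

Lemma cell_exists d D E s : star d s -> (1 <= D)%nat -> (1 <= E)%nat ->
  exists k, cell D E s k.
Proof.
  intros Hs HD HE. destruct (star_spoke_exists d s Hs) as [i0 Hi0].
  assert (exists i, (i < D)%nat /\ forall j, j <> i -> (j < D)%nat -> s j = 0) as [i [Hi Hz]].
  { unfold spoke in Hi0. destruct (le_lt_dec D i0) as [Hl|Hl].
    - exists 0%nat. split; auto. intros j _ Hj. rewrite Hi0.
      destruct (Nat.eqb_spec j i0); auto. lia.
    - exists i0. split; auto. intros j Hj _. rewrite Hi0.
      destruct (Nat.eqb_spec j i0); auto. contradiction. }
  destruct (grid_approx (s i) E (proj1 Hs i) HE) as [a [Ha Hta]].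
  exists (i * E + a)%nat. unfold cell.
  rewrite Nat.div_add_l, Nat.div_small, Nat.add_0_r by lia.
  rewrite (Nat.add_comm (i * E)), Nat.Div0.mod_add, Nat.mod_small by auto.
  split; [nia|auto].
Qed.

Lemma cell_close D E s s' k i : (1 <= E)%nat -> cell D E s k -> cell D E s' k ->
  (i < D)%nat -> Rabs (s i - s' i) <= / INR E.
Proof.
  intros HE [_ [H1 H2]] [_ [H1' H2']] Hi.
  assert (0 < / INR E) by (apply Rinv_0_lt_compat, lt_0_INR; lia).
  destruct (Nat.eq_dec i (k / E)) as [->|Hne].
  - rewrite S_INR in *. unfold Rdiv in *. rewrite Rmult_plus_distr_r in *.
    apply Rabs_le. lra.
  - rewrite H1, H1', Rminus_0_r, Rabs_R0 by auto. lra.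
Qed.

(* The code of [z] is a long word of its base sequence and, for each time window of length [G],
   the cell of the star coordinate at the only time in the window when the base sequence visits
   a small neighbourhood of [c]; at other times the word determines the star coordinate. *)
Lemma itinerary_codes e eps : 0 < e -> 0 < eps -> exists A, forall n,
  exists (L : list (list nat * list nat)) (code : space -> list nat * list nat),
  INR (length L) <= exp (A + (r + e) * INR n) /\ (forall z, In (code z) L) /\
  forall z z', code z = code z' -> forall k, (k < n)%nat ->
    dist (Nat.iter k step z) (Nat.iter k step z') <= eps.
Proof.
  intros He Heps. destruct (half_pow_small eps Heps) as [M HM].
  destruct (inv_INR_small eps Heps) as [E0 HE0]. specialize (HE0 E0 (le_n _)).
  set (E := S E0) in *. set (D := legs M). set (N := (D * E)%nat).
  assert (HD : (1 <= D)%nat) by (unfold D, legs; lia).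
  assert (HE : (1 <= E)%nat) by (unfold E; lia).
  assert (HN : 1 <= INR N) by (apply (le_INR 1); unfold N; nia).
  assert (HlnN : 0 <= ln (INR N)) by (rewrite <- ln_1; apply ln_le; lra).
  (* One of [N] cells per window of length [G] then costs at most [e / 2] per unit of time. *)
  assert (exists G, (1 <= G)%nat /\ ln (INR N) <= e / 2 * INR G) as [G [HG HlnG]].
  { destruct (INR_unbounded (ln (INR N) * 2 / e)) as [G0 HG0].
    exists (S G0). split; [lia|]. rewrite S_INR.
    apply Rmult_le_reg_l with (2 / e); [apply Rdiv_lt_0_compat; lra|].
    replace (2 / e * (e / 2 * (INR G0 + 1))) with (INR G0 + 1) by (field; lra).
    replace (2 / e * ln (INR N)) with (ln (INR N) * 2 / e) by (field; lra). lra. }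
  destruct (visits_sparse G) as [Q HQ].
  destruct (words_le r B (e / 2)) as [A0 HA0]; [lra|].
  (* Padding of the word: [M + Q] letters on either side for the metric window and for detecting
     visits, and [G] because the last time window may overshoot. *)
  set (K := (2 * M + 2 * Q + G)%nat).
  exists (A0 + (r + e / 2) * INR K + ln (INR N) + e / 2 * INR M).
  intros n. destruct (HA0 (n + K)%nat) as [W [HWlen HW]].
  (* Coordinate [j < M] at time [k < n] comes from coordinate [j + k], so the time windows must
     cover all times below [n + M]. *)
  set (V := ((n + M) / G + 1)%nat).
  assert (HV : (n + M < V * G /\ V * G <= n + M + G)%nat).
  { unfold V. pose proof (Nat.div_mod_eq (n + M) G).
    pose proof (Nat.mod_upper_bound (n + M) G ltac:(lia)). nia. }
  set (a0 := (- Z.of_nat (M + Q))%Z).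
  set (cel := fun s => epsilon (inhabits 0%nat) (cell D E s)).
  set (vis := fun z q => epsilon (inhabits 0%nat)
                (fun l => (q * G <= l < q * G + G)%nat /\ visit Q l z)).
  assert (Hcel : forall z l, cell D E (sp z l) (cel (sp z l))).
  { intros z l. apply (epsilon_spec (inhabits 0%nat) (cell D E (sp z l))).
    apply cell_exists with (legs l); auto. apply sp_star. }
  exists (list_prod W (tuples N V)),
    (fun z => (word (shift a0 (bs z)) 0 (n + K), map (fun q => cel (sp z (vis z q))) (seq 0 V))).
  split; [|split].
  - rewrite length_prod, length_tuples, mult_INR, pow_INR.
    assert (EV : INR N ^ V = exp (ln (INR N) * INR V)).
    { rewrite exp_mult_INR, exp_ln; lra. }
    rewrite EV.
    apply Rle_trans with (exp (A0 + (r + e / 2) * INR (n + K)) * exp (ln (INR N) * INR V)).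
    { apply Rmult_le_compat_r; auto. apply Rlt_le, exp_pos. }
    rewrite <- exp_plus. apply exp_le.
    assert (Hq : ((n + M) / G * G <= n + M)%nat).
    { pose proof (Nat.div_mod_eq (n + M) G). lia. }
    apply le_INR in Hq. unfold V. rewrite mult_INR, !plus_INR in *. change (INR 1) with 1.
    pose proof (pos_INR ((n + M) / G)).
    assert (ln (INR N) * INR ((n + M) / G) <= e / 2 * (INR n + INR M)) by nra.
    lra.
  - intros z. apply in_prod.
    + apply HW. apply shift_in, bs_in.
    + apply (in_tuples N (fun q => cel (sp z (vis z q)))). intros q. apply Hcel.
  - intros z z' Hcode k Hk. injection Hcode as Hword Hcells.
    assert (Hbs : forall m, (a0 <= m < a0 + Z.of_nat (n + K))%Z -> bs z m = bs z' m).
    { intros m Hm. unfold word in Hword.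
      assert (Hin : In (Z.to_nat (m - a0)) (seq 0 (n + K))) by (apply in_seq; lia).
      pose proof (ext_in_map Hword _ Hin) as H. unfold shift in H.
      rewrite Z2Nat.id in H by lia. replace (0 + (m - a0) + a0)%Z with m in H by lia. exact H. }
    assert (Hvis : forall l, (l < V * G)%nat -> visit Q l z -> visit Q l z').
    { intros l Hl Hz m Hm. rewrite <- Hz by auto. unfold shift. symmetry. apply Hbs. lia. }
    apply dist_le_window with M; [lra| |].
    + intros m Hm. rewrite !bs_iter. apply Hbs. lia.
    + intros j i Hj. rewrite !sp_iter.
      destruct (le_lt_dec (legs j) i) as [Hi|Hi].
      { rewrite !trunc_ge, Rminus_0_r, Rabs_R0 by auto. lra. }
      rewrite !trunc_lt by auto. set (l := (j + k)%nat).
      destruct (classic (visit Q l z)) as [Hv|Hv].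
      * set (q := (l / G)%nat).
        assert (Hlq : (q * G <= l < q * G + G)%nat).
        { unfold q. pose proof (Nat.div_mod_eq l G).
          pose proof (Nat.mod_upper_bound l G ltac:(lia)). nia. }
        assert (HqV : (q < V)%nat) by (unfold l in *; nia).
        assert (Hvl : forall z0, visit Q l z0 -> vis z0 q = l).
        { intros z0 Hz0.
          destruct (epsilon_spec (inhabits 0%nat)
                      (fun l => (q * G <= l < q * G + G)%nat /\ visit Q l z0)) as [H1 H2]; [eauto|].
          change ((q * G <= vis z0 q < q * G + G)%nat) in H1. change (visit Q (vis z0 q) z0) in H2.
          destruct (lt_eq_lt_dec (vis z0 q) l) as [[H|H]|H]; auto; exfalso.
          - specialize (HQ z0 _ _ H H2 Hz0). lia.
          - specialize (HQ z0 _ _ H Hz0 H2). lia. }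
        assert (Hin : In q (seq 0 V)) by (apply in_seq; lia).
        pose proof (ext_in_map Hcells _ Hin) as Hc. simpl in Hc.
        rewrite !Hvl in Hc; auto; [|apply Hvis; auto; unfold l; lia].
        apply Rle_trans with (/ INR E); [|lra].
        apply cell_close with D (cel (sp z l)); auto.
        -- rewrite Hc. apply Hcel.
        -- unfold D. pose proof (legs_mono j M). lia.
      * destruct (ring_below Q _ Hv) as [p [Hp Hr]].
        rewrite (sp_ring z l p), (sp_ring z' l p), Rminus_diag, Rabs_R0; auto; [lra|].
        apply ring_ext with (2 := Hr). intros m Hm. unfold shift. symmetry. apply Hbs.
        unfold l. lia.
Qed.

(** The itinerary coding for a single time step already yields finite nets. *)
Lemma space_compact : compact_space space.
Proof.
  apply complete_totally_bounded_compact; [|apply space_complete].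
  intros e He. destruct (itinerary_codes 1 e) as [A HA]; [lra|auto|].
  destruct (HA 1%nat) as [L [code [_ [HL Hc]]]].
  destruct (representatives (fun z x => code z = x) L) as [l Hl].
  exists l. intros z. destruct (Hl z (code z)) as [y [Hy E]]; auto.
  exists y. split; auto. apply (Hc y z E 0%nat). lia.
Qed.

Lemma separated_length_le e eps : 0 < e -> 0 < eps -> exists A, forall n l,
  n_eps_separated step n eps l -> INR (length l) <= exp (A + (r + e) * INR n).
Proof.
  intros He Heps. destruct (itinerary_codes e eps He Heps) as [A HA].
  exists A. intros n l [Hnd Hsep]. destruct (HA n) as [L [code [HL [Hin Hc]]]].
  apply Rle_trans with (2 := HL). apply le_INR.
  apply (length_le_codes (fun z x => code z = x)); auto.
  - intros x _. exists (code x). auto.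
  - intros x y w Hx Hy Ex Ey. apply NNPP. intros Hne.
    destruct (Hsep x y Hx Hy Hne) as [k [Hk Hd]].
    apply (Rgt_not_le _ _ Hd). apply (Hc x y); auto. congruence.
Qed.

Lemma max_sep_card_exists eps : 0 < eps -> exists s : nat -> nat,
  forall n, max_sep_card step n eps (s n).
Proof.
  intros Heps. destruct (separated_length_le 1 eps) as [A HA]; [lra|auto|].
  apply (choice (fun n k => max_sep_card step n eps k)). intros n.
  destruct (INR_unbounded (exp (A + (r + 1) * INR n))) as [M HM].
  destruct (exists_max (fun k => exists l, n_eps_separated step n eps l /\ length l = k) M)
    as [k [Hk Hmax]].
  - exists nil. split; auto. split; [constructor|]. intros x y [].
  - intros k [l [Hl <-]]. specialize (HA n l Hl). apply INR_le. lra.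
  - exists k. split; auto. intros l Hl. apply Hmax. eauto.
Qed.

Lemma max_sep_card_ge1 n eps k : max_sep_card step n eps k -> (1 <= k)%nat.
Proof.
  intros [_ H]. destruct (lift_exists c (base_in r B)) as [z _].
  apply (H [z]). split; [constructor; [simpl; auto|constructor]|].
  intros x y [<-|[]] [<-|[]] Hne. contradiction.
Qed.

Lemma max_sep_card_large_eps n eps k : 1 <= eps -> max_sep_card step n eps k -> k = 1%nat.
Proof.
  intros Heps H. pose proof (max_sep_card_ge1 n eps k H) as H1. destruct H as [[l [[Hnd Hl] <-]] _].
  destruct l as [|x [|y l]]; [simpl in H1; lia|reflexivity|]. exfalso.
  destruct (Hl x y) as [j [_ Hj]]; [simpl; auto|simpl; auto| |].
  - intros E. rewrite E in Hnd. inversion Hnd as [|? ? Hnin]. apply Hnin. simpl. auto.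
  - pose proof (dist_le1 (Nat.iter j step x) (Nat.iter j step y)). lra.
Qed.

(** Lifts of distinct words of length [n] carry different letters at coordinate [0] at some time
    below [n], where their distance is at least [1]. *)
Lemma max_sep_card_ge_exp N eps : eps < 1 -> exists n, (N <= n)%nat /\
  forall k, max_sep_card step n eps k -> exp (r * INR n) <= INR k.
Proof.
  intros Heps. destruct (words_ge r B N) as [n [Hn [l [Hl [HC Hnd]]]]].
  exists n. split; auto. intros k [_ Hk]. apply Rle_trans with (1 := Hl). apply le_INR.
  assert (Hlift : forall x, exists z : space, In x l -> forall m, bs z m = x m).
  { intros x. destruct (classic (In x l)) as [Hx|Hx].
    - destruct (lift_exists x (HC x Hx)) as [z Hz]. eauto.
    - destruct (lift_exists c (base_in r B)) as [z _]. exists z. tauto. }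
  apply choice in Hlift. destruct Hlift as [g Hg].
  rewrite <- (length_map g). apply Hk.
  assert (Hdiff : forall x y, In x l -> In y l -> g x <> g y ->
    exists j, (j < n)%nat /\ dist (Nat.iter j step (g x)) (Nat.iter j step (g y)) > eps).
  { intros x y Hx Hy Hne. apply NNPP. intros Hno. apply Hne. f_equal.
    assert (Hxy : word x 0 n = word y 0 n).
    { apply map_ext_in. intros j Hj. apply in_seq in Hj. apply NNPP. intros Hj2.
      apply Hno. exists j. split; [lia|]. apply Rlt_le_trans with 1; auto.
      change 1 with ((/2)^(Z.abs_nat 0)). apply bs_dist. rewrite !bs_iter, !Hg; auto. }
    clear - Hnd Hx Hy Hxy. induction l as [|a l IH]; [destruct Hx|].
    simpl in Hnd. inversion Hnd as [|? ? Hnin Hnd']; subst.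
    destruct Hx as [<-|Hx], Hy as [<-|Hy]; auto; exfalso; apply Hnin.
    - rewrite Hxy. apply (in_map (fun x => word x 0 n)). auto.
    - rewrite <- Hxy. apply (in_map (fun x => word x 0 n)). auto. }
  split.
  - apply NoDup_map_in.
    + apply NoDup_map_inv with (f := fun x => word x 0 n). auto.
    + intros x y Hx Hy E. apply functional_extensionality. intros m.
      rewrite <- (Hg x Hx), <- (Hg y Hy), E. reflexivity.
  - intros z z' Hz Hz' Hne. apply in_map_iff in Hz. apply in_map_iff in Hz'.
    destruct Hz as [x [<- Hx]], Hz' as [y [<- Hy]]. auto.
Qed.

Lemma separated_limsup s eps : 0 < eps < 1 -> (forall n, max_sep_card step n eps (s n)) ->
  limsup_eq (fun n => ln (INR (s (S n))) / INR (S n)) r.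
Proof.
  intros Heps Hs. split.
  - intros e He. destruct (separated_length_le (e / 2) eps) as [A HA]; [lra|lra|].
    (* Beyond this time the constant [A] is absorbed by [e / 2] per unit of time. *)
    destruct (INR_unbounded (2 * A / e)) as [N HN]. exists N. intros n Hn.
    assert (0 < INR (S n)) by (apply lt_0_INR; lia).
    apply Rmult_le_reg_r with (INR (S n)); auto.
    unfold Rdiv. rewrite Rmult_assoc, Rinv_l, Rmult_1_r by lra.
    apply Rle_trans with (A + (r + e / 2) * INR (S n)).
    + rewrite <- (ln_exp (A + (r + e / 2) * INR (S n))). apply ln_le.
      * apply lt_0_INR. pose proof (max_sep_card_ge1 _ _ _ (Hs (S n))). lia.
      * destruct (Hs (S n)) as [[l [Hl <-]] _]. auto.
    + assert (INR N <= INR (S n)) by (apply le_INR; lia).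
      assert (A <= e / 2 * INR (S n)); [|lra].
      apply Rmult_le_reg_l with (2 / e); [apply Rdiv_lt_0_compat; lra|].
      replace (2 / e * (e / 2 * INR (S n))) with (INR (S n)) by (field; lra).
      replace (2 / e * A) with (2 * A / e) by (field; lra). lra.
  - intros e He N. destruct (max_sep_card_ge_exp (S N) eps) as [n [Hn H]]; [lra|].
    destruct n as [|n]; [lia|]. exists n. split; [lia|].
    assert (0 < INR (S n)) by (apply lt_0_INR; lia).
    apply Rle_trans with r; [lra|].
    apply Rmult_le_reg_r with (INR (S n)); auto.
    unfold Rdiv. rewrite (Rmult_assoc (ln _)), Rinv_l, Rmult_1_r by lra.
    rewrite <- (ln_exp (r * INR (S n))). apply ln_le; [apply exp_pos|auto].
Qed.

(** The limsup equals [r] at every scale below [1] and vanishes from [1] on, because the diameter is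
    at most [1]; as [r >= 0], the supremum is [r]. *)
Lemma step_entropy : 0 <= r -> top_entropy_eq step r.
Proof.
  intros Hr. exists (fun eps => if Rlt_dec eps 1 then r else 0). split.
  - intros eps Heps. destruct (max_sep_card_exists eps Heps) as [s Hs].
    exists s. split; auto. destruct Rlt_dec as [Hlt|Hge].
    + apply separated_limsup with eps; auto.
    + assert (E : forall n, ln (INR (s (S n))) / INR (S n) = 0).
      { intros n. rewrite (max_sep_card_large_eps _ _ _ (Rnot_lt_le _ _ Hge) (Hs (S n))).
        change (INR 1) with 1. rewrite ln_1. unfold Rdiv. ring. }
      split; intros e He; [exists 0%nat; intros n _|intros N; exists N; split; auto];
        rewrite E; lra.
  - split.
    + intros y [eps [_ ->]]. destruct Rlt_dec; lra.
    + intros u Hu. apply Hu. exists (1/2). split; [lra|]. destruct Rlt_dec; lra.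
Qed.

(** * Rigidity *)

(** Removing a point other than the centre leaves at most two pieces, so three legs make the centre
    optimal. *)
Lemma legs_ge3 n : (3 <= legs n)%nat.
Proof. unfold legs. lia. Qed.

Lemma over_unique x n n' : over x n -> over x n' -> n = n'.
Proof. intros H H'. apply Nat2Z.inj. apply (shift_base_twice x); auto. Qed.

Lemma ring_or_over x n : (exists q, ring q (shift (Z.of_nat n) x)) \/ over x n.
Proof. apply ring_or_base. Qed.

Lemma sp_off_base (z w : space) n i : (forall m, bs z m = bs w m) -> ~ over (bs z) n ->
  sp z n i = sp w n i.
Proof.
  intros E Hn. destruct (ring_or_over (bs z) n) as [[q Hq]|H]; [|contradiction].
  rewrite (sp_ring z n q), (sp_ring w n q); auto.
  apply ring_ext with (2 := Hq). intros m _. unfold shift. auto.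
Qed.

Lemma fiber_singleton (z w : space) : (forall m, bs z m = bs w m) ->
  ~ (exists n, over (bs z) n) -> z = w.
Proof. intros E Hn. apply pt_ext; auto. intros n i. apply sp_off_base; eauto. Qed.

(** When [T^n z = c] no ring constrains coordinate [n], so it can be replaced by any star point. *)
Lemma spoke_blow (z : space) n i t : over (bs z) n ->
  in_blowup (bs z, fun n' => if (n' =? n)%nat then trunc (legs n) (spoke i (clip t)) else sp z n').
Proof.
  intros H. split; [apply bs_in|]. split; simpl.
  - intros n'. destruct (Nat.eqb_spec n' n) as [->|_]; [|apply sp_star].
    apply star_trunc with (S i). apply star_spoke, clip_bounds.
  - intros n' q Hq j. destruct (Nat.eqb_spec n' n) as [->|_]; [|apply sp_ring; auto].
    exfalso. apply (ring_not_base _ _ Hq). exact H.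
Qed.

Definition spoke_pt (z : space) (n : nat) (H : over (bs z) n) (i : nat) (t : R) : space :=
  exist in_blowup _ (spoke_blow z n i t H).

Section OneFiber.
Context (z : space) (n : nat) (H : over (bs z) n).
Notation P := (spoke_pt z n H).

Lemma sp_spoke_pt i t j : 0 <= t <= 1 -> sp (P i t) n j = trunc (legs n) (spoke i t) j.
Proof.
  intros Ht. unfold spoke_pt, sp. simpl. rewrite Nat.eqb_refl, clip_id; auto.
Qed.

Lemma sp_spoke_pt_other i t n' j : n' <> n -> sp (P i t) n' j = sp z n' j.
Proof.
  intros Hn. unfold spoke_pt, sp at 1. simpl.
  destruct (Nat.eqb_spec n' n); [contradiction|auto].
Qed.

Lemma sp_spoke_tip i t : (i < legs n)%nat -> 0 <= t <= 1 -> sp (P i t) n i = t.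
Proof.
  intros Hi Ht. rewrite sp_spoke_pt, trunc_lt by auto. unfold spoke.
  rewrite Nat.eqb_refl. reflexivity.
Qed.

Lemma spoke_pt_center i j : P i 0 = P j 0.
Proof.
  apply pt_ext; [reflexivity|]. intros n' k.
  destruct (Nat.eq_dec n' n) as [->|Hn]; [|rewrite !sp_spoke_pt_other; auto].
  rewrite !sp_spoke_pt by lra. unfold trunc, spoke.
  destruct (k <? legs n)%nat, (k =? i)%nat, (k =? j)%nat; reflexivity.
Qed.

Lemma spoke_pt_inj i j t t' : (i < legs n)%nat -> 0 < t <= 1 -> 0 <= t' <= 1 ->
  P i t = P j t' -> i = j /\ t = t'.
Proof.
  intros Hi Ht Ht' E. assert (Es : sp (P i t) n i = sp (P j t') n i) by (rewrite E; auto).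
  rewrite sp_spoke_tip, sp_spoke_pt, trunc_lt in Es by (auto; lra).
  unfold spoke in Es. destruct (Nat.eqb_spec i j); [auto|lra].
Qed.

(** Only coordinate [n] is free, all others being read off the base sequence, so the fibre is
    exactly the star. *)
Lemma fiber_spoke (w : space) : (forall m, bs z m = bs w m) ->
  exists i t, (i < legs n)%nat /\ 0 <= t <= 1 /\ w = P i t.
Proof.
  intros E. pose proof (sp_star w n) as Hs.
  assert (exists i t, (i < legs n)%nat /\ 0 <= t <= 1 /\
            forall j, sp w n j = trunc (legs n) (spoke i t) j) as [i [t [Hi [Ht Hw]]]].
  { destruct (star_spoke_exists _ _ Hs) as [i Hi]. destruct (le_lt_dec (legs n) i) as [Hl|Hl].
    - exists 0%nat, 0. pose proof (legs_ge3 n). split; [lia|]. split; [lra|]. intros j.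
      rewrite Hi, (proj1 (proj2 Hs) i Hl). unfold trunc, spoke.
      destruct (j <? legs n)%nat, (j =? i)%nat, (j =? 0)%nat; reflexivity.
    - exists i, (sp w n i). split; auto. split; [apply (proj1 Hs)|]. intros j.
      rewrite <- (trunc_star (legs n) (sp w n) j Hs). unfold trunc. rewrite (Hi j). reflexivity. }
  exists i, t. split; auto. split; auto. apply pt_ext; [intros m; symmetry; apply E|].
  intros n' j. destruct (Nat.eq_dec n' n) as [->|Hn].
  - rewrite sp_spoke_pt; auto.
  - rewrite sp_spoke_pt_other by auto. symmetry. apply sp_off_base; auto.
    intros Ho. apply Hn. apply (over_unique (bs z)); auto.
Qed.

Lemma spoke_pt_lipschitz i t t' : dist (P i t) (P i t') <= Rabs (t - t').
Proof.
  pose proof (Rabs_pos (t - t')). apply dist_le; auto. split.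
  - intros m Hm. exfalso. apply Hm. reflexivity.
  - intros n' j. destruct (Nat.eq_dec n' n) as [->|Hn].
    + unfold spoke_pt, sp. simpl. rewrite Nat.eqb_refl.
      apply Rle_trans with (Rabs (clip t - clip t')); [|apply clip_lipschitz].
      pose proof (half_pow_le1 n). pose proof (half_pow_pos n).
      assert (Hd : Rabs (trunc (legs n) (spoke i (clip t)) j - trunc (legs n) (spoke i (clip t')) j)
                   <= Rabs (clip t - clip t')).
      { apply Rle_trans with (1 := trunc_diff _ _ _ _). unfold spoke.
        destruct (j =? i)%nat; [lra|]. rewrite Rminus_diag, Rabs_R0. apply Rabs_pos. }
      pose proof (Rabs_pos (clip t - clip t')).
      pose proof (Rabs_pos (trunc (legs n) (spoke i (clip t)) j - trunc (legs n) (spoke i (clip t')) j)).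
      nra.
    + rewrite !sp_spoke_pt_other, Rminus_diag, Rabs_R0, Rmult_0_r; auto.
Qed.

Lemma spoke_path {T} (col : space -> T) i a a' : a <= a' ->
  (forall t, a <= t <= a' -> exists e, 0 < e /\
     forall t', a <= t' <= a' -> dist (P i t) (P i t') < e -> col (P i t') = col (P i t)) ->
  col (P i a) = col (P i a').
Proof.
  intros Ha Hloc. apply (locally_constant_interval a a' (fun t => col (P i t))); auto.
  intros t Ht. destruct (Hloc t Ht) as [e [He Hc]]. exists e. split; auto.
  intros t' Ht' Hd. apply Hc; auto. rewrite dist_sym.
  apply Rle_lt_trans with (1 := spoke_pt_lipschitz i t' t). exact Hd.
Qed.
End OneFiber.

(** Fixing a letter is a clopen condition, which separates different base sequences. Conversely a
    clopen set cannot cut a leg, and all legs of a star share the centre. *)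
Lemma linked_iff (z w : space) : linked z w <-> forall m, bs z m = bs w m.
Proof.
  split.
  - intros Hl m. symmetry. apply (Hl (fun w => bs w m = bs z m)); auto.
    + intros x Hx. exists ((/2)^(Z.abs_nat m)). split; [apply half_pow_pos|].
      intros y Hy. rewrite <- Hx. symmetry. apply bs_close; auto.
    + intros x Hx. exists ((/2)^(Z.abs_nat m)). split; [apply half_pow_pos|].
      intros y Hy E. apply Hx. rewrite <- E. apply bs_close; auto.
  - intros E U HU HU' Hz. destruct (classic (exists n, over (bs z) n)) as [[n H]|Hn].
    + set (col := fun x => if excluded_middle_informative (U x) then true else false).
      assert (Hcol : forall i t, 0 <= t <= 1 -> col (spoke_pt z n H i 0) = col (spoke_pt z n H i t)).
      { intros i t Ht. apply spoke_path; [lra|]. intros t0 _. unfold col.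
        destruct (excluded_middle_informative (U (spoke_pt z n H i t0))) as [H0|H0];
          [destruct (HU _ H0) as [e [He Hb]]|destruct (HU' _ H0) as [e [He Hb]]];
          exists e; split; auto; intros t' _ Hd; specialize (Hb _ Hd);
          destruct excluded_middle_informative; auto; contradiction. }
      destruct (fiber_spoke z n H z) as [i [t [_ [Ht Ez]]]]; auto.
      destruct (fiber_spoke z n H w E) as [j [t' [_ [Ht' Ew]]]].
      assert (Ecol : col z = col w).
      { transitivity (col (spoke_pt z n H i t)); [exact (f_equal col Ez)|].
        transitivity (col (spoke_pt z n H j t')); [|exact (f_equal col (eq_sym Ew))].
        rewrite <- (Hcol i t), <- (Hcol j t') by auto. f_equal. apply spoke_pt_center. }
      unfold col in Ecol. destruct (excluded_middle_informative (U z)); [|contradiction].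
      destruct (excluded_middle_informative (U w)); [auto|discriminate].
    + rewrite <- (fiber_singleton z w E Hn). exact Hz.
Qed.

Lemma branches_singleton (z : space) m : ~ (exists n, over (bs z) n) ->
  branches (linked z) m -> m = 0%nat.
Proof.
  intros Hn [p [col [Hp [_ Hs]]]]. destruct m as [|m]; auto. exfalso.
  destruct (Hs 0%nat) as [w [Hw [Hwp _]]]; [lia|]. apply Hwp.
  rewrite <- (fiber_singleton z w), <- (fiber_singleton z p); auto; apply linked_iff; auto.
Qed.

Lemma branches_legs (z : space) n : over (bs z) n -> branches (linked z) (legs n).
Proof.
  intros H. set (P := spoke_pt z n H).
  set (col := fun w : space => epsilon (inhabits 0%nat) (fun i => sp w n i <> 0)).
  assert (Hcol : forall (w : space) i, sp w n i <> 0 -> col w = i).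
  { intros w i Hi.
    assert (H0 : sp w n (col w) <> 0).
    { apply (epsilon_spec (inhabits 0%nat) (fun i => sp w n i <> 0)). eauto. }
    destruct (Nat.eq_dec (col w) i) as [E|E]; auto. exfalso.
    destruct (proj2 (proj2 (sp_star w n)) _ _ E); contradiction. }
  pose proof (legs_ge3 n) as H3.
  assert (Hl : forall i t, linked z (P i t)) by (intros i t; apply linked_iff; reflexivity).
  exists (P 0%nat 0), col. split; [|split]; auto.
  - intros w Hw Hwp. pose proof (proj1 (linked_iff z w) Hw) as Hwb.
    destruct (fiber_spoke z n H w Hwb) as [i [t [Hi [Ht E]]]]. fold P in E.
    assert (Ht0 : 0 < t).
    { destruct (Req_dec t 0) as [E0|]; [|lra]. exfalso. apply Hwp. rewrite E, E0.
      apply spoke_pt_center. }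
    assert (Hsp : sp w n i = t) by (rewrite E; apply sp_spoke_tip; auto).
    (* Any point with vanishing coordinate on leg [i] is at least this far from [w], so nearer
       points lie on the same leg. *)
    exists ((/2)^n * t). pose proof (half_pow_pos n). split; [nra|]. intros w' _ _ Hd.
    rewrite (Hcol w i), (Hcol w' i); auto; [|lra]. intros E0.
    pose proof (sp_dist w w' n i) as Hd'.
    rewrite E0, Hsp, Rminus_0_r, Rabs_right in Hd' by lra. lra.
  - intros i Hi. exists (P i 1). split; auto.
    assert (Hsp : sp (P i 1) n i = 1) by (apply sp_spoke_tip; auto; lra).
    split; [|apply Hcol; lra]. intros E.
    destruct (spoke_pt_inj z n H i 0 1 0); auto; lra.
Qed.

(** A colour is constant along every segment avoiding the removed point [p]. If [p] is the centre,
    the tips carry all colours; otherwise the centre and the outer end of the leg of [p] do. *)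
Lemma branches_le_legs (z : space) n m :
  over (bs z) n -> branches (linked z) m -> (m <= legs n)%nat.
Proof.
  intros H [p [col [Hp [Hloc Hs]]]]. set (P := spoke_pt z n H). pose proof (legs_ge3 n) as H3.
  assert (Hl : forall i t, linked z (P i t)) by (intros i t; apply linked_iff; reflexivity).
  assert (Hpath : forall i a a', a <= a' -> (forall t, a <= t <= a' -> P i t <> p) ->
            col (P i a) = col (P i a')).
  { intros i a a' Ha Hav. apply spoke_path; auto. intros t Ht.
    destruct (Hloc (P i t)) as [e [He Hc]]; auto. exists e. auto. }
  assert (Hcodes : forall L, (forall w, linked z w -> w <> p -> In (col w) L) -> (m <= length L)%nat).
  { intros L HL. rewrite <- (length_seq m 0). apply NoDup_incl_length; [apply seq_NoDup|].
    intros k Hk. apply in_seq in Hk. destruct (Hs k) as [w [Hw [Hwp <-]]]; [lia|auto]. }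
  pose proof (proj1 (linked_iff z p) Hp) as Hpb. destruct (fiber_spoke z n H p Hpb) as [i0 [t0 [Hi0 [Ht0 Ep]]]].
  fold P in Ep. destruct (Req_dec t0 0) as [E0|E0].
  - rewrite <- (length_seq (legs n) 0), <- (length_map (fun i => col (P i 1))).
    apply Hcodes. intros w Hw Hwp. pose proof (proj1 (linked_iff z w) Hw) as Hwb.
    destruct (fiber_spoke z n H w Hwb) as [i [t [Hi [Ht E]]]]. fold P in E.
    assert (0 < t).
    { destruct (Req_dec t 0) as [E1|]; [|lra]. exfalso. apply Hwp.
      rewrite E, Ep, E0, E1. apply spoke_pt_center. }
    apply in_map_iff. exists i. split; [|apply in_seq; lia].
    rewrite E. symmetry. apply Hpath; [lra|]. intros t' Ht' E'. rewrite Ep, E0 in E'.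
    destruct (spoke_pt_inj z n H i i0 t' 0); auto; lra.
  - apply Nat.le_trans with (length [col (P 0%nat 0); col (P i0 1)]); [|simpl; lia].
    apply Hcodes. intros w Hw Hwp. pose proof (proj1 (linked_iff z w) Hw) as Hwb.
    destruct (fiber_spoke z n H w Hwb) as [i [t [Hi [Ht E]]]]. fold P in E.
    assert (Hinj : forall j t', 0 <= t' <= 1 -> P j t' = p -> i0 = j /\ t0 = t').
    { intros j t' Ht' E'. rewrite Ep in E'. apply (spoke_pt_inj z n H i0 j t0 t'); auto. lra. }
    destruct (classic (i = i0 /\ t0 <= t)) as [[-> Hle]|Hno].
    + right. left. rewrite E. symmetry. apply Hpath; [lra|]. intros t' Ht' E'.
      destruct (Hinj i0 t') as [_ Et]; auto; [lra|]. apply Hwp. rewrite E, Ep. f_equal. lra.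
    + left. rewrite E. transitivity (col (P i 0)); [f_equal; apply spoke_pt_center|].
      apply Hpath; [lra|]. intros t' Ht' E'.
      destruct (Hinj i t') as [Ei Et]; auto; [lra|]. apply Hno. split; auto. lra.
Qed.
End Blowup.

(** * Homeomorphisms between blow-ups *)

Section Rigidity.
Context {r : R} (B : subshift r).
Notation C := (pts r B).
Notation c := (base r B).

Lemma over_legs_eq b b' n n' : legs b n = legs b' n' -> n = n' /\ b n = b' n'.
Proof.
  unfold legs. intros E. assert (n = n') as <- by (destruct (b n), (b' n'); lia).
  split; auto. destruct (b n), (b' n); auto; lia.
Qed.

(** Comparing branch numbers through [f] and through its inverse gives equal leg numbers, and these
    determine both [n] and the bit. Two parameters are allowed so that the same lemma gives rigidity
    and non-homeomorphy. *)
Lemma homeo_over b b' (f : space B b -> space B b') g z n : is_homeo f g ->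
  over B (bs B b z) n -> over B (bs B b' (f z)) n /\ b n = b' n.
Proof.
  intros Hfg H. pose proof (branches_homeo f g z _ Hfg (branches_legs B b z n H)) as Hbr.
  destruct (classic (exists n', over B (bs B b' (f z)) n')) as [[n' H']|Hno].
  - pose proof (branches_le_legs B b' (f z) n' _ H' Hbr) as Hle.
    destruct Hfg as [Hf [Hg [Hgf Hfg]]].
    assert (Hgf' : is_homeo g f) by (split; [|split; [|split]]; auto).
    pose proof (branches_homeo g f (f z) _ Hgf' (branches_legs B b' (f z) n' H')) as Hbr'.
    rewrite Hgf in Hbr'. pose proof (branches_le_legs B b z n _ H Hbr') as Hle'.
    destruct (over_legs_eq b b' n n') as [<- Eb]; [lia|]. auto.
  - apply branches_singleton in Hbr; auto. pose proof (legs_ge3 b n). lia.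
Qed.

Lemma over_exists b n : exists z : space B b, over B (bs B b z) n.
Proof.
  destruct (lift_exists B b (shift (- Z.of_nat n) c)) as [z Hz].
  - apply shift_in, base_in.
  - exists z. intros m. rewrite Hz. unfold shift. f_equal. lia.
Qed.

Lemma homeomorphic_params_eq b b' : homeomorphic (space B b) (space B b') -> b = b'.
Proof.
  intros [f [g Hfg]]. apply functional_extensionality. intros n.
  destruct (over_exists b n) as [z Hz]. apply (homeo_over b b' f g z n Hfg Hz).
Qed.

Lemma over_dense b (z : space B b) e : 0 < e ->
  exists (z' : space B b) n, over B (bs B b z') n /\ dist z z' <= e.
Proof.
  intros He. destruct (cylinder_in_ball B b z e He) as [y [Q [Hy HQ]]].
  destruct (recurrent r B c y Q (base_in r B) Hy) as [G HG].
  (* The return time is sought in [[-G, 0]], so that the shifted [c] lies on the backward orbit. *)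
  destruct (HG (- G)%Z) as [t [Ht Hm]].
  destruct (lift_exists B b (shift t c)) as [z' Hz']; [apply shift_in, base_in|].
  exists z', (Z.to_nat (- t)). split.
  - intros m. rewrite Hz'. unfold shift. f_equal. lia.
  - apply HQ. intros m Hmq. rewrite Hz'. apply Hm; auto.
Qed.

Lemma not_over_dense b (z : space B b) e : 0 < e ->
  exists z' : space B b, ~ (exists n, over B (bs B b z') n) /\ dist z z' <= e.
Proof.
  intros He. destruct (cylinder_in_ball B b z e He) as [y [Q [Hy HQ]]].
  destruct (recurrent r B c y Q (base_in r B) Hy) as [G HG].
  (* A positive return time gives a point of the strict forward orbit of [c], which by aperiodicity
     never comes back to [c]. *)
  destruct (HG 1%Z) as [t [Ht Hm]].
  destruct (lift_exists B b (shift t c)) as [z' Hz']; [apply shift_in, base_in|].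
  exists z'. split.
  - intros [n Hn]. destruct (aperiodic r B (t + Z.of_nat n)%Z) as [m Hne]; [lia|].
    apply Hne. rewrite <- (Hn m), Hz'. unfold shift. f_equal. lia.
  - apply HQ. intros m Hmq. rewrite Hz'. apply Hm; auto.
Qed.

Lemma homeo_bs b (f g : space B b -> space B b) z m : is_homeo f g ->
  bs B b (f z) m = bs B b z m.
Proof.
  intros Hfg. pose proof (half_pow_pos (Z.abs_nat m)) as Hpos.
  destruct (proj1 Hfg z _ Hpos) as [d [Hd Hc]].
  destruct (over_dense b z (Rmin d ((/2)^(Z.abs_nat m)) / 2)) as [z' [n [Hn Hz]]].
  { unfold Rmin. destruct Rle_dec; lra. }
  assert (Hz1 : dist z z' < d /\ dist z z' < (/2)^(Z.abs_nat m)).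
  { revert Hz. unfold Rmin. destruct Rle_dec; lra. }
  rewrite (bs_close B b (f z) (f z')), (bs_close B b z z') by (try apply Hc; apply Hz1).
  destruct (homeo_over b b f g z' n Hfg Hn) as [Hn' _].
  specialize (Hn (m - Z.of_nat n)%Z). specialize (Hn' (m - Z.of_nat n)%Z).
  replace (m - Z.of_nat n + Z.of_nat n)%Z with m in * by lia. congruence.
Qed.

Lemma space_rigid b : trivial_homeo_group (space B b).
Proof.
  intros f g Hfg z. apply NNPP. intros Hne.
  assert (Hpos : 0 < dist (f z) z).
  { destruct (Rle_lt_or_eq_dec _ _ (dist_nonneg _ (f z) z)) as [|E]; auto.
    exfalso. apply Hne. apply (dist_eq0 (space B b)). auto. }
  set (e := dist (f z) z) in *.
  destruct (proj1 Hfg z (e / 2)) as [d [Hd Hc]]; [lra|].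
  destruct (not_over_dense b z (Rmin d (e / 2) / 2)) as [z' [Hn Hz]].
  { unfold Rmin. destruct Rle_dec; lra. }
  assert (Hz1 : dist z z' < d /\ dist z z' < e / 2).
  { revert Hz. unfold Rmin. destruct Rle_dec; lra. }
  assert (E : z' = f z').
  { apply fiber_singleton; auto. intros m. symmetry. apply homeo_bs with g; auto. }
  specialize (Hc z' (proj1 Hz1)). rewrite <- E in Hc.
  pose proof (dist_tri _ (f z) z' z) as Ht. rewrite (dist_sym _ z' z) in Ht.
  fold e in Ht. lra.
Qed.
End Rigidity.

Lemma bool_seq_uncountable : uncountable (nat -> bool).
Proof.
  intros [f Hf].
  (* Cantor's diagonal against an injection: [d] disagrees at [n] with the sequence numbered [n], if
     there is one. *)
  set (d := fun n => if excluded_middle_informative (exists b, f b = n /\ b n = true)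
                     then false else true).
  destruct (d (f d)) eqn:E; pose proof E as E'; unfold d at 1 in E';
    destruct excluded_middle_informative as [[b [Hb Hbt]]|Hn]; try discriminate.
  - apply Hn. exists d. auto.
  - apply Hf in Hb. subst b. congruence.
Qed.

Theorem theorem4p1 :
  (exists (I : Type) (X : I -> MetricSpace),
     uncountable I /\
     (forall i, compact_space (X i) /\ minimal_space (X i) /\ trivial_homeo_group (X i)) /\
     (forall i j, i <> j -> ~ homeomorphic (X i) (X j)))
  /\
  (forall r : R, 0 <= r ->
     exists (X : MetricSpace) (f : X -> X),
       compact_space X /\ trivial_homeo_group X /\ minimal_map f /\ top_entropy_eq f r).
Proof.
  split.
  (* One subshift serves for the whole family; only the bits in the leg numbers vary. *)
  - destruct (subshift_exists 0 (Rle_refl 0)) as [B]. exists (nat -> bool), (space B).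
    split; [apply bool_seq_uncountable|]. split.
    + intros b. split; [apply space_compact|]. split; [|apply space_rigid].
      exists (step B b). apply step_minimal.
    + intros b b' Hne Hh. apply Hne, (homeomorphic_params_eq B), Hh.
  - intros r Hr. destruct (subshift_exists r Hr) as [B]. set (b := fun _ : nat => false).
    exists (space B b), (step B b). split; [apply space_compact|].
    split; [apply space_rigid|]. split; [apply step_minimal|]. apply step_entropy, Hr.
Qed.
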